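(* Let $X$ and $Y$ be Banach spaces such that the pair $(X,Y)$ has properties (LE) and (LA$_1$). Then there is a constant $K>0$ depending only on $X$ and $Y$ such that the following holds. Let $A\subset X$ be closed and suppose that $f\colon A\to Y$ satisfies condition (W) with a mapping $G\colon A\to\mathcal L(X;Y)$. Then $f$ can be extended to a mapping $g\in C^1(X;Y)$. Moreover, if $f$ is $L$-Lipschitz and $\sup_{x\in A}\|G(x)\|\le L$, then one can additionally assert that $g$ is $KL$-Lipschitz.
   Context: All normed linear spaces are real. $U(x,r)$ is the open ball with centre $x$ and radius $r$, $U_X$ is the open unit ball of $X$. An $L$-Lipschitz mapping is a mapping with a (not necessarily minimal) Lipschitz constant $L$. $\mathcal L(X;Y)$ is the normed space of continuous linear operators from $X$ to $Y$. For open $\Omega\subset X$, $C^k(\Omega;Y)$ is the space of $C^k$-smooth (in the Fréchet sense) mappings from $\Omega$ to $Y$. Condition (W): a mapping $f\colon A\to Y$, $A\subset X$, satisfies condition (W) with $G$ if $G\colon A\to\mathcal L(X;Y)$ is continuous and for each $x\in A$ the operator $G(x)$ is a strict derivative of $f$ at $x$ with respect to $A$, i.e. for each $\varepsilon>0$ there is $\delta>0$ such that $\|f(z)-f(y)-G(x)[z-y]\|\le\varepsilon\|z-y\|$ whenever $y,z\in U(x,\delta)\cap A$. Property (LE): the pair $(X,Y)$ of normed linear spaces has property (LE) if there is $C>0$ such that for every $A\subset X$ every $L$-Lipschitz mapping $f\colon A\to Y$ has a $CL$-Lipschitz extension to the whole of $X$. Property (LA$_k$), $k\in\mathbb N\cup\{\infty\}$: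 the pair $(X,Y)$ of normed linear spaces has property (LA$_k$) if there is $C\ge0$ such that for any $L$-Lipschitz mapping $f\colon U_X\to Y$ and any $\varepsilon>0$ there is a $CL$-Lipschitz mapping $g\in C^k(U_X;Y)$ such that $\sup_{U_X}\|f-g\|\le\varepsilon$. *)

(* Defs.v *)
From HB Require Import structures.
From mathcomp Require Import all_boot all_order all_algebra.
From mathcomp Require Import all_classical all_reals.
From mathcomp Require Import topology normedtype landau sequences derive.

Set Implicit Arguments.
Unset Strict Implicit.
Unset Printing Implicit Defensive.

Import Order.TTheory GRing.Theory Num.Theory.
Import numFieldNormedType.Exports.

Local Open Scope classical_set_scope.
Local Open Scope ring_scope.

Section ContinuousLinearOperators.
Context {R : realType} (X Y : normedModType R).

Definition clin_pred : {pred X -> Y} :=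
  fun T => `[< linear T /\ continuous T >].

Record clin := CLin { clin_fun :> X -> Y ; _ : clin_fun \in clin_pred }.

HB.instance Definition _ := [isSub for clin_fun].
HB.instance Definition _ := [Choice of clin by <:].

Lemma clinP (T : clin) : linear T /\ continuous T.
Proof. by case: T => T /= /asboolP. Qed.

Lemma clin_continuous (T : clin) : continuous T.
Proof. by have [] := clinP T. Qed.

HB.instance Definition _ (T : clin) :=
  GRing.isLinear.Build R X Y *:%R T (clinP T).1.

Lemma clin_submod_closed : submod_closed clin_pred.
Proof.
split=> [|a S T /asboolP[Sl Sc] /asboolP[Tl Tc]]; apply/asboolP; split.
- by move=> a x y; rewrite /= scaler0 addr0.
- exact: cst_continuous.
- move=> b x y; rewrite !fctE Sl Tl !scalerDr !scalerA (mulrC a b).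
  by rewrite -!addrA; congr (_ + _); rewrite addrCA.
- move=> x; apply: cvgD; last exact: Tc.
  by apply: cvgZr; exact: Sc.
Qed.

HB.instance Definition _ :=
  GRing.isSubmodClosed.Build R (X -> Y) clin_pred clin_submod_closed.
HB.instance Definition _ := [SubChoice_isSubLmodule of clin by <:].

Definition opnorm (T : clin) : R := sup [set `|T x| | x in [set x | `|x| <= 1]].

Lemma has_sup_opnorm (T : clin) :
  has_sup [set `|T x| | x in [set x | `|x| <= 1]].
Proof.
split; first by exists `|T 0|; exists 0 => //=; rewrite normr0.
have /linear_bounded_continuous/bounded_funP/(_ 1)[M TM] := @clin_continuous T.
by exists M => _ [x /= x1 <-]; exact: TM.
Qed.

Lemma opnorm_ub (T : clin) x : `|x| <= 1 -> `|T x| <= opnorm T.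
Proof.
move=> x1; apply: sup_upper_bound; first exact: has_sup_opnorm.
by exists x.
Qed.

Lemma opnorm_le (T : clin) M :
  (forall x, `|x| <= 1 -> `|T x| <= M) -> opnorm T <= M.
Proof.
move=> TM; apply: ge_sup; first by have [] := has_sup_opnorm T.
by move=> _ [x /= x1 <-]; exact: TM.
Qed.

Lemma ler_opnormD (S T : clin) : opnorm (S + T) <= opnorm S + opnorm T.
Proof.
apply: opnorm_le => x x1.
by rewrite (le_trans (ler_normD _ _)) ?lerD ?opnorm_ub.
Qed.

Lemma opnormZ (a : R) (T : clin) : opnorm (a *: T) = `|a| * opnorm T.
Proof.
have le b (S : clin) : opnorm (b *: S) <= `|b| * opnorm S.
  apply: opnorm_le => x x1.
  rewrite [X in `|X|](_ : _ = b *: S x)//.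
  by rewrite normrZ ler_wpM2l ?opnorm_ub.
apply/eqP; rewrite eq_le le /=.
have [->|a0] := eqVneq a 0.
  rewrite normr0 mul0r (le_trans _ (@opnorm_ub _ 0 _))// normr0 //.
have := le a^-1 (a *: T).
rewrite scalerA mulVf// scale1r normfV.
by rewrite ler_pdivlMl ?normr_gt0.
Qed.

Lemma opnorm_eq0 (T : clin) : opnorm T = 0 -> T = 0.
Proof.
move=> T0; apply/val_inj/funext => x /=; change (T x = 0).
have [->|x0] := eqVneq x 0; first exact: linear0.
have : `|T (`|x|^-1 *: x)| <= 0.
  rewrite -T0 opnorm_ub// normrZ normfV normr_id mulVf ?normr_eq0//.
rewrite normr_le0 linearZ scaler_eq0 invr_eq0 normr_eq0 (negbTE x0) /=.
by move/eqP.
Qed.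

HB.instance Definition _ :=
  Lmodule_isNormed.Build R clin ler_opnormD opnormZ opnorm_eq0.

Lemma clin_normE (T : clin) : `|T| = opnorm T. Proof. by []. Qed.

End ContinuousLinearOperators.

Section SmoothnessAndExtension.
Context {R : realType} (X : normedModType R).

(* Meant for open O: continuity and differentiability at the points of O are
   those of a map on X, which for open O depend on its restriction to O only. *)
Fixpoint Cn (n : nat) (Y : normedModType R) (O : set X) (f : X -> Y) : Prop :=
  if n is m.+1 then
    exists2 D : X -> clin X Y,
      (forall x, O x -> is_diff x f (D x)) & @Cn m (clin X Y) O D
  else forall x, O x -> {for x, continuous f}.

(* Some n encodes the finite order n, None encodes the order infinity. *)
Definition Ck (k : option nat) (Y : normedModType R) (O : set X) (f : X -> Y) :=
  if k is Some n then Cn n O f else forall n, Cn n O f.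

Variable Y : normedModType R.

(* Throughout, a map defined on a subset A of X is represented by a function
   on X whose values outside A are irrelevant. *)
Definition strict_derivative (A : set X) (f : X -> Y) (T : clin X Y) (x : X) :=
  forall e : R, 0 < e -> exists2 d : R, 0 < d &
    forall y z, A y -> A z -> ball x d y -> ball x d z ->
      `|f z - f y - T (z - y)| <= e * `|z - y|.

Definition condition_W (A : set X) (f : X -> Y) (G : X -> clin X Y) :=
  {within A, continuous G} /\ forall x, A x -> strict_derivative A f (G x) x.

(* 0 <= L matters: on a singleton every map satisfies the Lipschitz inequality
   with any negative constant. *)
Definition property_LE := exists2 C : R, 0 < C &
  forall (A : set X) (f : X -> Y) (L : R), 0 <= L -> L.-lipschitz_A f ->
    exists g : X -> Y, (forall x, A x -> g x = f x) /\ (C * L).-lipschitz g.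

Definition property_LA (k : option nat) := exists2 C : R, 0 <= C &
  forall (f : X -> Y) (L e : R), 0 <= L -> L.-lipschitz_(ball 0 1) f -> 0 < e ->
    exists g : X -> Y, [/\ (C * L).-lipschitz_(ball 0 1) g,
      Ck k (ball 0 1) g & forall x, ball 0 1 x -> `|f x - g x| <= e].

End SmoothnessAndExtension.

Arguments property_LE {R} X Y.
Arguments property_LA {R} X Y k.

(* Main.v *)
From HB Require Import structures.
Require Import Defs.
From mathcomp Require Import all_boot all_order all_algebra.
From mathcomp Require Import all_classical all_reals.
From mathcomp Require Import topology normedtype landau sequences derive.
From mathcomp Require Import wochoice lra ring ssrAC.

Set Implicit Arguments.
Unset Strict Implicit.
Unset Printing Implicit Defensive.

Import Order.TTheory GRing.Theory Num.Theory.
Import numFieldNormedType.Exports.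

Local Open Scope classical_set_scope.
Local Open Scope ring_scope.

(** The extension is a limit of C^1 maps on X. If f is L-Lipschitz on A with
    derivative data G bounded by L, a C^1 map g on X is found which is
    KL-Lipschitz and such that f - g is L/2-Lipschitz on A and G - Dg is
    bounded by L/2 there ([halving_step]). Condition (W) passes to
    (f - g, G - Dg), so the step can be repeated with L/2, L/4, ...; after
    normalisation at one point of A the maps found in this way sum, with their
    derivatives, to a 2KL-Lipschitz C^1 map that agrees with f on A
    ([lipschitz_extension]). Near each of its points a general f satisfying
    (W) is Lipschitz with bounded G, so it has C^1 extensions locally, and these
    are glued ([smooth_extension]).

    C^1 maps are handled through strict derivatives at all points: a map is
    C^1 exactly when it has one everywhere ([Cn1_sd], [sd_Cn1]). A strict
    derivative says that f - T has arbitrarily small Lipschitz constants near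
    the point, so that derivatives, Lipschitz constants and uniform limits are
    all treated by the same estimates.

    All constructions rest on one gluing principle ([smooth_gluing]): for every
    x a ball around x is given and, for every e > 0, a smooth piece p x e on
    it. The pieces can be blended into one smooth map h such that whatever the
    pieces satisfy up to e - being close to a map F with p x e - F
    c-Lipschitz on a set B, or having a derivative c-close to G at a point -
    holds for h with c replaced by c + delta. Behind it lie a sigma-discrete
    refinement of the cover ([sigma_discrete]), which leaves a sequence of
    maps only, and C^1 cutoffs obtained from (LA_1) and a linear functional
    on Y ([smooth_cutoff]). The accuracy e used at level n is chosen much
    smaller than the inverse of the Lipschitz constant of the n-th cutoff, so
    that the blending costs almost nothing.

    The halving step uses the principle twice. Around a point a of A,
    (W) makes f - G a Lipschitz on A with a small constant; (LE) extends this
    difference and (LA_1) smooths it, and adding G a back gives the pieces near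
    A. Blending them yields a C^1 map h with h - f Lipschitz on A with a
    small constant, and Dh close to G on A ([approx_derivative]), but no
    bound on h away from A. However, h is 2L-Lipschitz near each point of A,
    hence 7L-Lipschitz on a neighbourhood of A ([lip_near_union]); (LE) extends
    it from there, and blending this Lipschitz extension near A with its smooth
    approximations off A makes it C^1 and keeps it Lipschitz
    ([make_lipschitz]). *)

(** * Lipschitz maps and bounded operators *)

(** Agrees with the filter-based Lipschitz condition, see [lipP]; this form is
    the one that is applied to pairs of points throughout. *)
Definition lip {R : realType} {X Y : normedModType R} (B : set X) (c : R)
  (f : X -> Y) := forall y z, B y -> B z -> `|f y - f z| <= c * `|y - z|.

Section Basics.
Context {R : realType} {X Y : normedModType R}.

Lemma lipP (B : set X) c (f : X -> Y) : c.-lipschitz_B f <-> lip B c f.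
Proof.
split=> [H y z By Bz|H [y z] /= [By Bz]]; last exact: H.
by apply: (H (y, z)).
Qed.

Lemma in_ball (x y : X) r : ball x r y = (`|y - x| < r) :> Prop.
Proof. by rewrite -ball_normE /= distrC. Qed.

Lemma clin_le (T : clin X Y) v : `|T v| <= `|T| * `|v|.
Proof.
have [->|v0] := eqVneq v 0; first by rewrite linear0 !normr0 mulr0.
have vp : 0 < `|v| by rewrite normr_gt0.
have := @opnorm_ub R X Y T (`|v|^-1 *: v).
rewrite linearZ /= !normrZ normfV normr_id mulVf ?gt_eqF // => /(_ (lexx _)).
by rewrite ler_pdivrMl // mulrC.
Qed.

Lemma clin_norm_le (T : clin X Y) c : 0 <= c ->
  (forall v, `|T v| <= c * `|v|) -> `|T| <= c.
Proof.
move=> c0 H; apply: opnorm_le => v v1; apply: le_trans (H v) _.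
by rewrite ler_piMr.
Qed.

Lemma bounded_linear_clin (T : X -> Y) c : linear T ->
  (forall v, `|T v| <= c * `|v|) -> T \in @clin_pred R X Y.
Proof.
move=> Tl Tc; apply/asboolP; split=> //.
pose T' := HB.pack_for {linear X -> Y} T (GRing.isLinear.Build R X Y *:%R T Tl).
have : bounded_near T' (nbhs 0).
  apply/linear_boundedP; exists c; split; first exact: num_real.
  by move=> r cr x; apply: le_trans (Tc x) _; rewrite ler_wpM2r // ltW.
by move/linear_bounded_continuous.
Qed.

Lemma exists_clin (T : X -> Y) c : linear T -> (forall v, `|T v| <= c * `|v|) ->
  exists S : clin X Y, forall v, S v = T v.
Proof. by move=> Tl Tc; exists (CLin (bounded_linear_clin Tl Tc)). Qed.

Lemma clinD (S T : clin X Y) v : (S + T) v = S v + T v. Proof. by []. Qed.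
Lemma clinN (S : clin X Y) v : (- S) v = - S v. Proof. by []. Qed.
Lemma clinB (S T : clin X Y) v : (S - T) v = S v - T v. Proof. by []. Qed.
Lemma clin0 v : (0 : clin X Y) v = 0. Proof. by []. Qed.
Lemma clinZ a (T : clin X Y) v : (a *: T) v = a *: T v. Proof. by []. Qed.

Lemma clin_scale (T : clin X Y) a v : T (a *: v) = a *: T v.
Proof. exact: linearZ. Qed.

Lemma clin_sub (T : clin X Y) u v : T (u - v) = T u - T v.
Proof. exact: linearB. Qed.

End Basics.

(** * Calculus of strict derivatives *)

(** The strict derivative relative to the whole space: f - T is e-Lipschitz
    near x for each e > 0. *)
Definition sd {R : realType} {X Y : normedModType R} (f : X -> Y)
    (T : clin X Y) (x : X) :=
  forall e : R, 0 < e -> exists2 d : R, 0 < d &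
    forall y z, `|y - x| < d -> `|z - x| < d ->
      `|f z - f y - T (z - y)| <= e * `|z - y|.

Section StrictDerivative.
Context {R : realType} {X Y : normedModType R}.
Implicit Types (f g : X -> Y) (S T : clin X Y).

Lemma sd_strict A f T x : sd f T x -> strict_derivative A f T x.
Proof.
move=> H e /H[d d0 Hd]; exists d => // y z _ _ yd zd.
by apply: Hd; rewrite -in_ball.
Qed.

Lemma sd_eq_near f g T x :
  (exists2 d : R, 0 < d & forall y, `|y - x| < d -> f y = g y) ->
  sd f T x -> sd g T x.
Proof.
move=> [d d0 fg] H e /H[r r0 Hr]; exists (Num.min d r).
  by rewrite lt_min d0.
by move=> y z; rewrite !lt_min => /andP[yd yr] /andP[zd zr]; rewrite -!fg ?Hr.
Qed.

Lemma sd_cst (c : Y) x : sd (fun _ : X => c) 0 x.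
Proof.
move=> e e0; exists 1 => // y z _ _.
by rewrite subrr clin0 subr0 normr0 mulr_ge0 // ltW.
Qed.

Lemma sd_clin T x : sd T T x.
Proof.
move=> e e0; exists 1 => // y z _ _.
by rewrite linearB subrr normr0 mulr_ge0 // ltW.
Qed.

Lemma sdD f g S T x : sd f S x -> sd g T x -> sd (fun y => f y + g y) (S + T) x.
Proof.
move=> Hf Hg e e0; have e2 : 0 < e / 2 by rewrite divr_gt0.
have [d d0 Hd] := Hf _ e2; have [r r0 Hr] := Hg _ e2.
exists (Num.min d r); first by rewrite lt_min d0.
move=> y z; rewrite !lt_min => /andP[yd yr] /andP[zd zr].
rewrite clinD (_ : _ - _ - _ =
  (f z - f y - S (z - y)) + (g z - g y - T (z - y))); last first.
  by rewrite !opprD !addrA [LHS](ACl (1*3*5*2*4*6)).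
apply: le_trans (ler_normD _ _) _; apply: le_trans (lerD (Hd _ _ _ _) (Hr _ _ _ _)) _ => //.
by rewrite -mulrDl -splitr.
Qed.

Lemma sdZ a f T x : sd f T x -> sd (fun y => a *: f y) (a *: T) x.
Proof.
move=> H e e0; have [|d d0 Hd] := H (e / (`|a| + 1)).
  by rewrite divr_gt0 // ltr_wpDl.
exists d => // y z yd zd; rewrite clinZ -!scalerBr normrZ.
apply: le_trans (ler_wpM2l (normr_ge0 a) (Hd _ _ yd zd)) _.
rewrite mulrA ler_wpM2r // mulrCA ger_pMr //.
by rewrite ler_pdivrMr ?ltr_wpDl // mul1r lerDl.
Qed.

Lemma sdN f T x : sd f T x -> sd (fun y => - f y) (- T) x.
Proof.
move=> H e /H[d d0 Hd]; exists d => // y z yd zd.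
by rewrite clinN -!opprD normrN Hd.
Qed.

Lemma sdB f g S T x : sd f S x -> sd g T x -> sd (fun y => f y - g y) (S - T) x.
Proof. by move=> Hf Hg; apply: sdD => //; apply: sdN. Qed.

Lemma sd_lip f T x : sd f T x ->
  exists2 d : R, 0 < d & lip (ball x d) (`|T| + 1) f.
Proof.
move=> /(_ 1 ltr01)[d d0 Hd]; exists d => // z y; rewrite !in_ball => zd yd.
rewrite -[f z - f y](subrK (T (z - y))) mulrDl addrC.
apply: le_trans (ler_normD _ _) _.
by rewrite lerD ?clin_le // Hd.
Qed.

Lemma sd_continuous f T x e : sd f T x -> 0 < e ->
  exists2 d : R, 0 < d & forall y, `|y - x| < d -> `|f y - f x| <= e.
Proof.
move=> /sd_lip[d d0 Hd] e0; have M0 : 0 < `|T| + 1 by rewrite ltr_wpDl.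
exists (Num.min d (e / (`|T| + 1))); first by rewrite lt_min d0 divr_gt0.
move=> y; rewrite lt_min => /andP[yd ye].
apply: le_trans (Hd _ _ _ _) _; rewrite ?in_ball ?subrr ?normr0 //.
by rewrite -ler_pdivlMl // mulrC ltW.
Qed.

(** A Lipschitz constant near x bounds the difference quotients, and T v is the
    limit of those along v. *)
Lemma sd_norm_le f T x c : 0 <= c -> sd f T x ->
  (exists2 d : R, 0 < d & lip (ball x d) c f) -> `|T| <= c.
Proof.
move=> c0 H [d d0 Hd]; apply/ler_addgt0Pr => e e0.
have [r r0 Hr] := H _ e0.
apply: clin_norm_le => [|v]; first by rewrite addr_ge0 // ltW.
pose m := Num.min d r; have m0 : 0 < m by rewrite lt_min d0.
pose t := m / (`|v| + 1).
have v0 : 0 < `|v| + 1 by rewrite ltr_wpDl.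
have t0 : 0 < t by rewrite divr_gt0.
have tv : `|x + t *: v - x| < m.
  rewrite addrC addKr normrZ gtr0_norm // mulrAC ltr_pdivrMr //.
  by rewrite ltr_pM2l // ltrDl.
have xx : `|x - x| < m by rewrite subrr normr0.
have := tv; rewrite {1}lt_min => /andP[td tr].
have := xx; rewrite {1}lt_min => /andP[xd xr].
have := Hr _ _ xr tr; have := Hd (x + t *: v) x.
rewrite !in_ball => /(_ td xd) H1 H2.
have : `|T (t *: v)| <= (c + e) * `|t *: v|.
  rewrite -[X in `|X|](subKr (f (x + t *: v) - f x)).
  apply: le_trans (ler_normB _ _) _.
  move: H1 H2; rewrite (addrC x) addrK => H1 H2.
  by rewrite mulrDl lerD.
rewrite linearZ !normrZ mulrCA ler_pM2l //.
by rewrite -normrM normr_gt0 gt_eqF.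
Qed.

End StrictDerivative.

Section StrictDerivativeRules.
Context {R : realType} {X Y : normedModType R}.
Implicit Types (f g : X -> Y) (S T : clin X Y).

Lemma sd_scale (p : X -> R^o) (P : clin X R^o) f T x :
  sd p P x -> sd f T x ->
  exists2 Q : clin X Y, (forall v, Q v = p x *: T v + P v *: f x) &
    sd (fun y => p y *: f y) Q x.
Proof.
move=> Hp Hf.
have [Q HQ] : exists Q : clin X Y, forall v, Q v = p x *: T v + P v *: f x.
  apply: (@exists_clin _ _ _ _ (`|p x| * `|T| + `|P| * `|f x|)).
    move=> a u v; rewrite (linearP T) (linearP P) !scalerDr !scalerDl !scalerA.
    by rewrite [p x * a]mulrC addrACA.
  move=> v; rewrite mulrDl; apply: le_trans (ler_normD _ _) _.
  apply: lerD; rewrite normrZ; first by rewrite -mulrA ler_wpM2l // clin_le.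
  by rewrite mulrAC ler_wpM2r // clin_le.
exists Q => // e e0.
pose M : R := `|p x| + `|P| + `|T| + `|f x| + 1.
have M0 : 0 < M by rewrite /M ltr_wpDl // !addr_ge0.
(* The increment error splits into four terms, each of which is at most
   h M |z - y|. *)
pose h := Num.min 1 (e / (4 * M)).
have h0 : 0 < h by rewrite lt_min ltr01 divr_gt0 // mulr_gt0.
have h1 : h <= 1 by rewrite ge_min lexx.
have hM : 4 * (h * M) <= e.
  by rewrite mulrCA -ler_pdivlMr ?mulr_gt0 // ge_min lexx orbT.
have [d1 d10 H1] := Hp _ h0; have [d2 d20 H2] := Hf _ h0.
have [d3 d30 H3] := sd_continuous Hp h0; have [d4 d40 H4] := sd_continuous Hf h0.
pose d := Num.min (Num.min d1 d2) (Num.min d3 d4).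
exists d; first by rewrite !lt_min d10 d20 d30.
move=> y z; rewrite !lt_min => /andP[/andP[y1 y2] /andP[y3 y4]].
move=> /andP[/andP[z1 z2] /andP[z3 z4]].
rewrite HQ; pose w := z - y; rewrite -/w.
have -> : p z *: f z - p y *: f y - (p x *: T w + P w *: f x) =
  p z *: (f z - f y - T w) + (p z - p x) *: T w
  + (p z - p y - P w) *: f y + P w *: (f y - f x).
  rewrite !scalerBr !scalerBl opprD.
  rewrite subrKA -[RHS]addrA subrKA [X in _ = X + _]addrAC.
  rewrite -[X in _ = _ + X]addrA subrKA.
  by rewrite !addrA [LHS](ACl (1*3*2*4)).
have w0 := normr_ge0 w.
have pz : `|p z| <= M.
  rewrite -[p z](subrK (p x)); apply: le_trans (ler_normD _ _) _.
  apply: le_trans (lerD (le_trans (H3 _ z3) h1) (lexx _)) _.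
  by rewrite /M; have := normr_ge0 P; have := normr_ge0 T;
     have := normr_ge0 (f x); lra.
have fy : `|f y| <= M.
  rewrite -[f y](subrK (f x)); apply: le_trans (ler_normD _ _) _.
  apply: le_trans (lerD (le_trans (H4 _ y4) h1) (lexx _)) _.
  by rewrite /M; have := normr_ge0 P; have := normr_ge0 T;
     have := normr_ge0 (p x); lra.
have TM : `|T w| <= M * `|w|.
  apply: le_trans (clin_le _ _) _; rewrite ler_wpM2r // /M.
  have := normr_ge0 P; have := normr_ge0 (f x);
     have := normr_ge0 (p x); lra.
have PM : `|P w| <= M * `|w|.
  apply: le_trans (clin_le _ _) _; rewrite ler_wpM2r // /M.
  have := normr_ge0 T; have := normr_ge0 (f x);
     have := normr_ge0 (p x); lra.
apply: (@le_trans _ _ (4 * (h * M) * `|w|)); last by rewrite ler_wpM2r.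
rewrite (_ : 4 * (h * M) * `|w| = M * (h * `|w|) + h * (M * `|w|) +
  h * `|w| * M + M * `|w| * h); last by lra.
apply: le_trans (ler_normD _ _) _; apply: lerD; last first.
  by rewrite normrZ ler_pM // H4.
apply: le_trans (ler_normD _ _) _; apply: lerD; last first.
  by rewrite normrZ ler_pM // H1.
apply: le_trans (ler_normD _ _) _; apply: lerD; last first.
  by rewrite normrZ ler_pM // H3.
by rewrite normrZ ler_pM // H2.
Qed.

Lemma sd_comp {Z : normedModType R} (f : X -> Y) (g : Y -> Z) (T : clin X Y)
  (S : clin Y Z) x : sd f T x -> sd g S (f x) ->
  exists2 U : clin X Z, (forall v, U v = S (T v)) & sd (g \o f) U x.
Proof.
move=> Hf Hg.
have [U HU] : exists U : clin X Z, forall v, U v = S (T v).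
  apply: (@exists_clin _ _ _ _ (`|S| * `|T|)).
    by move=> a u v; rewrite (linearP T) (linearP S).
  move=> v; apply: le_trans (clin_le _ _) _.
  by rewrite -mulrA ler_wpM2l // clin_le.
exists U => // e e0.
have [r r0 Hr] := sd_lip Hf; set L := `|T| + 1 in Hr.
have L0 : 0 < L by rewrite ltr_wpDl.
pose h := e / (2 * (L + `|S|)).
have LS : 0 < L + `|S| by rewrite ltr_wpDr.
have h0 : 0 < h by rewrite divr_gt0 // mulr_gt0.
have [d d0 Hd] := Hf _ h0; have [c c0 Hc] := Hg _ h0.
have c20 : 0 < c / 2 by rewrite divr_gt0.
have [q q0 Hq] := sd_continuous Hf c20.
exists (Num.min (Num.min d q) r); first by rewrite !lt_min d0 q0.
move=> y z; rewrite !lt_min => /andP[/andP[yd yq] yr] /andP[/andP[zd zq] zr].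
rewrite HU /=.
have -> : g (f z) - g (f y) - S (T (z - y)) =
  (g (f z) - g (f y) - S (f z - f y)) + S (f z - f y - T (z - y)).
  by rewrite [S (_ - T _)](linearB S) addrA subrK.
apply: le_trans (ler_normD _ _) _.
apply: (@le_trans _ _ (h * (L * `|z - y|) + `|S| * (h * `|z - y|))).
  apply: lerD.
    apply: le_trans (Hc _ _ _ _) _.
    - by apply: le_lt_trans (Hq _ yq) _; lra.
    - by apply: le_lt_trans (Hq _ zq) _; lra.
    by rewrite ler_pM2l // Hr // in_ball.
  by apply: le_trans (clin_le _ _) _; rewrite ler_wpM2l // Hd.
rewrite (_ : _ + _ = (h * (L + `|S|)) * `|z - y|); last by lra.
rewrite ler_wpM2r // /h invfM mulrA divfK ?gt_eqF //.
by lra.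
Qed.

End StrictDerivativeRules.

(** * Strict derivatives and C^1 maps *)

(** The mean value inequality for vector-valued maps, without functionals: the
    set of t with |v t - v 0| <= c t contains its supremum, and the local bound
    pushes that supremum up to 1. *)
Lemma slope_le_of_local {R : realType} {Y : normedModType R} (v : R -> Y)
    (c : R) :
  (forall t, 0 <= t <= 1 -> exists2 d : R, 0 < d &
     forall s, 0 <= s <= 1 -> `|s - t| < d -> `|v s - v t| <= c * `|s - t|) ->
  `|v 1 - v 0| <= c.
Proof.
move=> H.
pose S := [set t : R | 0 <= t <= 1 /\ `|v t - v 0| <= c * t].
have S0 : S 0 by split; rewrite ?lexx ?ler01 // subrr normr0 mulr0.
have Sub : ubound S 1 by move=> t [/andP[]].
have hS : has_sup S by split; [exists 0|exists 1].
set s := sup S.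
have s01 : 0 <= s <= 1.
  by rewrite sup_upper_bound //= ge_sup //; exists 0.
have [d d0 Hd] := H _ s01.
have Ss : S s.
  split=> //; have [t St] := sup_adherent d0 hS; rewrite -/s => st.
  have ts : t <= s by exact: sup_upper_bound.
  have [t01 Ht] := St.
  rewrite -(subrKA (v t)); apply: le_trans (ler_normD _ _) _.
  have := Hd _ t01; rewrite distrC ger0_norm ?subr_ge0 // => Hd'.
  apply: le_trans (lerD _ Ht) _; last first.
    instantiate (1 := c * (s - t)); lra.
  by rewrite distrC; apply: Hd'; lra.
have [_ Hs] := Ss; case/andP: s01 => s0 s1.
have [s1'|s1'] := eqVneq s 1; first by move: Hs; rewrite s1' mulr1.
have {}s1 : s < 1 by rewrite lt_neqAle s1'.
pose t := Num.min 1 (s + d / 2).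
have st : s < t by rewrite lt_min s1 ltrDl divr_gt0.
have t1 : t <= 1 by rewrite ge_min lexx.
have td : t - s < d.
  have : t <= s + d / 2 by rewrite ge_min lexx orbT.
  lra.
suff : S t by move/(sup_upper_bound hS); rewrite leNgt st.
have t01 : 0 <= t <= 1 by rewrite t1 andbT; lra.
split=> //; have := Hd _ t01; rewrite ger0_norm ?subr_ge0 ?(ltW st) // => /(_ td).
move=> Hts; rewrite -(subrKA (v s)); apply: le_trans (ler_normD _ _) _.
by apply: le_trans (lerD Hts Hs) _; lra.
Qed.

Section SmoothMaps.
Context {R : realType} {X Y : normedModType R}.
Implicit Types (g : X -> Y).

Lemma is_diff_near g (T : clin X Y) w e : is_diff w g T -> 0 < e ->
  exists2 d : R, 0 < d & forall v, `|v - w| < d ->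
    `|g v - g w - T (v - w)| <= e * `|v - w|.
Proof.
move=> [dg dT] e0.
have [_] := (diff_locallyP w g).1 dg; rewrite dT => /eqaddoP/(_ e e0).
move=> /nbhs_ballP[d /= d0 Hd]; exists d => // v vw.
have := Hd (v - w); rewrite in_ball subr0 => /(_ vw).
by rewrite !fctE /= subrK opprD addrA.
Qed.

(** On a small ball the derivative varies little, so g - D x has small slope
    at every point of a segment in that ball; the mean value inequality turns
    this into a Lipschitz bound. *)
Lemma Cn1_sd (O : set X) g : open O -> Cn 1 O g ->
  exists D : X -> clin X Y, forall x, O x -> sd g (D x) x.
Proof.
move=> oO [D dD cD]; exists D => x Ox e e0.
have e20 : 0 < e / 2 by rewrite divr_gt0.
have : \forall w \near x, O w /\ `|D w - D x| < e / 2.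
  apply: filterI; first exact: open_nbhs_nbhs.
  have /cvgrPdistC_lt/(_ _ e20) := cD _ Ox; exact.
move=> /nbhs_ballP[d /= d0 Hd]; exists d => // y z yd zd.
have Hd' w : `|w - x| < d -> O w /\ `|D w - D x| < e / 2.
  by rewrite -in_ball; exact: Hd.
pose w t := y + t *: (z - y).
have wB s t : w s - w t = (s - t) *: (z - y).
  by rewrite /w opprD addrACA subrr add0r -scalerBl.
have wx t : 0 <= t <= 1 -> `|w t - x| < d.
  move=> /andP[t0 t1].
  have -> : w t - x = (1 - t) *: (y - x) + t *: (z - x).
    rewrite /w scalerBl scale1r -[z - y](subrKA x) scalerDr -(opprB y x) scalerN.
    by rewrite !addrA [LHS](ACl (1*4*3*2)).
  apply: le_lt_trans (ler_normD _ _) _; rewrite !normrZ.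
  rewrite [`|1 - t|]ger0_norm ?subr_ge0 // [`|t|]ger0_norm //.
  have [->|tn0] := eqVneq t 0; first by rewrite subr0 mul1r mul0r addr0.
  have tp : 0 < t by rewrite lt_neqAle eq_sym tn0.
  have : t * `|z - x| < t * d by rewrite ltr_pM2l.
  have : (1 - t) * `|y - x| <= (1 - t) * d.
    by apply: ler_wpM2l; [rewrite subr_ge0|exact: ltW].
  lra.
pose v t := g (w t) - D x (w t).
have vB s t : v s - v t = g (w s) - g (w t) - D x (w s - w t).
  by rewrite (linearB (D x)) /v !opprD !opprK !addrA [LHS](ACl (1*3*2*4)).
have := @slope_le_of_local R Y v (e * `|z - y|).
rewrite vB wB subr0 scale1r.
have -> : w 1 = z by rewrite /w scale1r addrC subrK.
have -> : w 0 = y by rewrite /w scale0r addr0.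
apply => t t01.
have [Ot Dt] := Hd' _ (wx _ t01).
have [q q0 Hq] := is_diff_near (dD _ Ot) e20.
exists (q / (`|z - y| + 1)); first by rewrite divr_gt0 // ltr_wpDl.
move=> s s01 st; rewrite vB.
have stq : `|w s - w t| < q.
  rewrite wB normrZ; move: st; rewrite ltr_pdivlMr ?ltr_wpDl //.
  by apply: le_lt_trans; rewrite ler_wpM2l // lerDl.
have -> : e * `|z - y| * `|s - t| = e * `|w s - w t|.
  by rewrite wB normrZ -mulrA [`|z - y| * _]mulrC.
rewrite [e]splitr mulrDl.
rewrite -[X in `|X|](subrKA (D (w t) (w s - w t))).
apply: le_trans (ler_normD _ _) _; apply: lerD; first exact: Hq.
rewrite -clinB; apply: le_trans (clin_le _ _) _.
by rewrite ler_wpM2r // ltW.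
Qed.

Lemma sd_is_diff g (T : clin X Y) x : sd g T x -> is_diff x g T.
Proof.
move=> H.
have dT : 'd g x = T :> (X -> Y).
  apply: diff_unique; first exact: clin_continuous.
  apply/eqaddoP => e e0; have [d d0 Hd] := H _ e0.
  apply/nbhs_ballP; exists d => // v; rewrite in_ball subr0 => vd.
  rewrite !fctE /= opprD addrA.
  have := Hd x (v + x); rewrite addrK subrr normr0; exact.
apply: DiffDef => //; apply/diff_locallyP; split.
  by rewrite dT; exact: clin_continuous.
rewrite dT; apply/eqaddoP => e e0; have [d d0 Hd] := H _ e0.
apply/nbhs_ballP; exists d => // v; rewrite in_ball subr0 => vd.
rewrite !fctE /= opprD addrA.
have := Hd x (v + x); rewrite addrK subrr normr0; exact.
Qed.

(** Continuity is automatic: g - D x is e-Lipschitz near x, and D w - D x is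
    the derivative of this map at each nearby w. *)
Lemma sd_derivative_continuous g (D : X -> clin X Y) :
  (forall x, sd g (D x) x) -> forall x e, 0 < e ->
  exists2 d : R, 0 < d & forall w, `|w - x| < d -> `|D w - D x| <= e.
Proof.
move=> H x e e0.
have e20 : 0 < e / 2 by rewrite divr_gt0.
have [d d0 Hd] := H x _ e20; exists (d / 2) => [|w wd]; first by rewrite divr_gt0.
have B : sd (fun y => g y - D x y) (D w - D x) w.
  by apply: sdB => //; exact: sd_clin.
apply: (sd_norm_le (ltW e0) B); exists (d / 2); first by rewrite divr_gt0.
move=> y z; rewrite !in_ball => yw zw.
have near_x u : `|u - w| < d / 2 -> `|u - x| < d.
  move=> uw; rewrite -(subrKA w); apply: le_lt_trans (ler_normD _ _) _.
  by rewrite [d]splitr ltrD.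
rewrite (_ : _ - _ - _ = g y - g z - D x (y - z)); last first.
  by rewrite (linearB (D x)) !opprD !opprK !addrA [LHS](ACl (1*3*2*4)).
apply: le_trans (Hd _ _ (near_x _ zw) (near_x _ yw)) _.
by rewrite ler_wpM2r // [leRHS]splitr lerDl ltW.
Qed.

Lemma sd_Cn1 g (D : X -> clin X Y) : (forall x, sd g (D x) x) -> Cn 1 setT g.
Proof.
move=> H; exists D; first by move=> x _; exact: sd_is_diff.
move=> x _; apply/cvgrPdistC_le => e e0.
have [d d0 Hd] := sd_derivative_continuous H x e0.
by apply/nbhs_ballP; exists d => // w; rewrite in_ball; exact: Hd.
Qed.

End SmoothMaps.

(** * Limits and rescaling *)

Section Geometric.
Context {R : realType}.

Lemma exists_geo_lt (M e : R) : 0 < e -> exists n, M * 2^-1 ^+ n < e.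
Proof.
move=> e0; have := archi_boundP (normr_ge0 (M / e)).
set n := (X in _ < X%:R) => Mn; exists n.
rewrite exprVn ltr_pdivrMr ?exprn_gt0 // -ltr_pdivrMl // mulrC.
apply: le_lt_trans (ler_norm _) _; apply: lt_trans Mn _.
by rewrite -natrX ltr_nat ltn_expl.
Qed.

Lemma le0_geo (M x : R) : (forall n, x <= M * 2^-1 ^+ n) -> x <= 0.
Proof.
move=> H; rewrite leNgt; apply/negP => /(exists_geo_lt M)[n].
by rewrite ltNge H.
Qed.

Lemma geo_cauchy_lim {Y : completeNormedModType R} (u : nat -> Y) (K : R) :
  (forall n m, (n <= m)%N -> `|u m - u n| <= K * 2^-1 ^+ n) ->
  exists l, forall n, `|l - u n| <= K * 2^-1 ^+ n.
Proof.
move=> H.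
have cu : cvgn u.
  apply/cauchy_cvgP/cauchy_exP => e e0.
  have [n Hn] := exists_geo_lt K e0; exists (u n); exists n => // m /= nm.
  by rewrite in_ball; apply: le_lt_trans (H _ _ nm) Hn.
exists (limn u) => n; apply/ler_addgt0Pl => e e0.
have /cvgrPdist_le/(_ _ e0) [N _ HN] := cu.
have := HN (maxn n N) (leq_maxr _ _); rewrite distrC => H1.
rewrite distrC -(subrKA (u (maxn n N))); apply: le_trans (ler_normD _ _) _.
by rewrite addrC lerD // distrC H // leq_maxl.
Qed.
End Geometric.

(** The maps s m - s n have small Lipschitz constants, which bound the
    norms of D m - D n; so the operators D n converge pointwise, at a geometric
    rate, to a bounded operator. It is a strict derivative of f at x because
    f - s n and T - D n both have small Lipschitz constants. *)
Lemma sd_limit {R : realType} {X : normedModType R}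
    {Y : completeNormedModType R} (s : nat -> X -> Y)
    (D : nat -> clin X Y) (f : X -> Y) (K : R) (x : X) : 0 <= K ->
  (forall n, sd (s n) (D n) x) ->
  (forall n, lip setT (K * 2^-1 ^+ n) (fun y => f y - s n y)) ->
  exists T : clin X Y, sd f T x.
Proof.
move=> K0 sD fs.
have g0 n : 0 <= K * 2^-1 ^+ n by rewrite mulr_ge0 // exprn_ge0 // invr_ge0.
have Dnm n m : (n <= m)%N -> `|D m - D n| <= (2 * K) * 2^-1 ^+ n.
  move=> nm; apply: (sd_norm_le _ (sdB (sD m) (sD n))).
    by rewrite -mulrA mulr_ge0.
  exists 1 => // y z _ _.
  have -> : s m y - s n y - (s m z - s n z) =
    (f y - s n y - (f z - s n z)) - (f y - s m y - (f z - s m z)).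
    have E (a b c d e h : Y) : a - b - (c - d) = e - b - (h - d) - (e - a - (h - c)).
      rewrite !opprD !opprK !addrA [RHS](ACl (6*2*8*4*(1*5)*(3*7))) /=.
      by rewrite subrr addNr !addr0.
    exact: E.
  apply: le_trans (ler_normB _ _) _.
  apply: le_trans (lerD (fs n _ _ I I) (fs m _ _ I I)) _.
  have : K * 2^-1 ^+ m <= K * 2^-1 ^+ n.
    by apply: ler_wpM2l => //; apply: ler_wiXn2l => //; lra.
  move=> /(ler_wpM2r (normr_ge0 (y - z))); lra.
have /choice[T HT] v : exists l, forall n,
    `|l - D n v| <= (2 * K * `|v|) * 2^-1 ^+ n.
  apply: geo_cauchy_lim => n m nm; rewrite -clinB.
  apply: le_trans (clin_le _ _) _.
  by rewrite mulrAC ler_wpM2r // Dnm.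
have [S HS] : exists S : clin X Y, forall v, S v = T v.
  apply: (@exists_clin _ _ _ _ (`|D 0%N| + 2 * K)) => [a u v|v].
    apply/eqP; rewrite -subr_eq0 -normr_le0.
    apply: (@le0_geo _ (2 * K * `|a *: u + v| + `|a| * (2 * K * `|u|) + 2 * K * `|v|)).
    move=> n.
    have -> : T (a *: u + v) - (a *: T u + T v) =
      (T (a *: u + v) - D n (a *: u + v)) - a *: (T u - D n u) - (T v - D n v).
      have E (p q r d e : Y) : p - (q + r) = p - (d + e) - (q - d) - (r - e).
        rewrite !opprD !opprK !addrA [RHS](ACl (1*4*6*(2*5)*(3*7))) /=.
        by rewrite !addNr !addr0.
      by rewrite (linearP (D n)) [a *: (T u - _)]scalerBr; exact: E.
    apply: le_trans (ler_normB _ _) _; rewrite mulrDl; apply: lerD; last exact: HT.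
    apply: le_trans (ler_normB _ _) _; rewrite mulrDl; apply: lerD; first exact: HT.
    by rewrite normrZ -[leRHS]mulrA ler_wpM2l.
  rewrite -[T v](subrK (D 0%N v)) mulrDl addrC.
  apply: le_trans (ler_normD _ _) _; apply: lerD; first exact: clin_le.
  by have := HT v 0%N; rewrite expr0 mulr1.
exists S => e e0.
have [n Hn] : exists n, (3 * K) * 2^-1 ^+ n < e / 2.
  by apply: exists_geo_lt; rewrite divr_gt0.
have [d d0 Hd] := sD n (e / 2) ltac:(by rewrite divr_gt0).
exists d => // y z yd zd; rewrite HS.
have -> : f z - f y - T (z - y) =
  (s n z - s n y - D n (z - y)) + ((f z - s n z) - (f y - s n y))
  - (T (z - y) - D n (z - y)).
  have E (a b t a' b' t' : Y) : a - b - t = a' - b' - t' + (a - a' - (b - b')) - (t - t').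
    rewrite !opprD !opprK !addrA [RHS](ACl (4*6*8*(1*5)*(2*7)*(3*9))) /=.
    by rewrite subrr !addNr !addr0.
  exact: E.
apply: le_trans (ler_normB _ _) _.
apply: le_trans (lerD (ler_normD _ _) (HT _ n)) _.
apply: le_trans (lerD (lerD (Hd _ _ yd zd) (fs n _ _ I I)) (lexx _)) _.
have := ler_wpM2r (normr_ge0 (z - y)) (ltW Hn); lra.
Qed.

(** Dilations transport (LA_1) from the unit ball to any ball, with the same
    constant: the radius cancels. *)
Lemma property_LA_ball {R : realType} {X Y : normedModType R} :
  property_LA X Y (Some 1%N) -> exists2 C : R, 0 < C &
  forall (x0 : X) (r : R) (f : X -> Y) (L e : R), 0 < r -> 0 <= L -> 0 < e ->
    lip (ball x0 r) L f -> exists g D, [/\ lip (ball x0 r) (C * L) g,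
      forall x, ball x0 r x -> sd g (D x) x &
      forall x, ball x0 r x -> `|f x - g x| <= e].
Proof.
move=> [C C0 HC]; exists (C + 1); first by rewrite ltr_wpDl.
move=> x0 r f L e r0 L0 e0 Lf.
have inb z : ball (0 : X) 1 z -> ball x0 r (x0 + r *: z).
  rewrite !in_ball subr0 addrC addKr normrZ gtr0_norm // => z1.
  by rewrite gtr_pMr.
have outb y : ball x0 r y -> ball (0 : X) 1 (r^-1 *: (y - x0)).
  rewrite !in_ball subr0 normrZ gtr0_norm ?invr_gt0 // => yr.
  by rewrite mulrC ltr_pdivrMr // mul1r.
have inoutK y : x0 + r *: (r^-1 *: (y - x0)) = y.
  by rewrite scalerA divff ?gt_eqF // scale1r addrC subrK.
have Lf1 : (L * r).-lipschitz_(ball 0 1) (fun z => f (x0 + r *: z)).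
  apply/lipP => y z /inb yb /inb zb; apply: le_trans (Lf _ _ yb zb) _.
  rewrite opprD addrACA subrr add0r -scalerBr normrZ gtr0_norm //.
  by rewrite mulrA.
have [g [/lipP Lg Cg fg]] := HC _ (L * r) e ltac:(by rewrite mulr_ge0 // ltW) Lf1 e0.
have [|D HD] := Cn1_sd _ Cg; first exact: ball_open.
have affine x : exists U : clin X X, sd (fun y => r^-1 *: (y - x0)) U x.
  have [U HU] : exists U : clin X X, forall v, U v = v.
    by apply: (@exists_clin _ _ _ _ 1) => // v; rewrite mul1r.
  exists (r^-1 *: (U - 0)); apply: sdZ; apply: sdB; last exact: sd_cst.
  by apply: sd_eq_near (sd_clin U x); exists 1 => // y _; rewrite HU.
have /choice[D' HD'] x : exists T : clin X Y, ball x0 r x ->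
    sd (fun y => g (r^-1 *: (y - x0))) T x.
  have [xb|] := pselect (ball x0 r x); last by exists 0.
  have [U HU] := affine x.
  by have [T _ HT] := sd_comp HU (HD _ (outb _ xb)); exists T.
exists (fun y => g (r^-1 *: (y - x0))), D'; split=> //; last first.
  by move=> y yb; rewrite -{1}(inoutK y); apply: fg; exact: outb.
move=> y z /outb yb /outb zb; apply: le_trans (Lg _ _ yb zb) _.
rewrite -scalerBr opprB addrA subrK normrZ gtr0_norm ?invr_gt0 //.
rewrite !mulrA mulfK ?gt_eqF // ler_wpM2r //.
by rewrite ler_wpM2r // lerDl.
Qed.

(** * Functionals and smooth cutoff functions *)

Section Functional.
Context {R : realType} {V : normedModType R}.
Implicit Types (q : V -> R) (x y v : V).

(** An inequality is enough for positive homogeneity: rescaling by the inverse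
    of t gives the converse, see [sublinZ]. Infima are easier to treat this way. *)
Definition sublin q := [/\ (forall x y, q (x + y) <= q x + q y),
  (forall t x, 0 < t -> q (t *: x) <= t * q x) & (forall x, q x <= `|x|)].

Lemma sublin0 q : sublin q -> q 0 = 0.
Proof.
move=> [_ qZ qn]; apply/eqP; rewrite eq_le.
have := qn 0; rewrite normr0 => -> /=.
have := qZ 2 0 (ltr0n _ 2); rewrite scaler0; lra.
Qed.

Lemma sublinZ q t x : sublin q -> 0 <= t -> q (t *: x) = t * q x.
Proof.
move=> sq; rewrite le_eqVlt => /predU1P[<-|t0].
  by rewrite scale0r mul0r sublin0.
have [_ qZ _] := sq; apply/eqP; rewrite eq_le qZ //=.
have := qZ t^-1 (t *: x); rewrite invr_gt0 => /(_ t0).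
by rewrite scalerA mulVf ?gt_eqF // scale1r ler_pdivlMl.
Qed.

Lemma sublin_ge q x : sublin q -> - `|x| <= q x.
Proof.
move=> sq; have [qD _ qn] := sq.
have := qD x (- x); rewrite subrr (sublin0 sq).
have := qn (- x); rewrite normrN; lra.
Qed.

(** The sublinear functional that lies below q and is pushed down as far as
    possible along v; a q that cannot be pushed down is additive. *)
Definition slide q v x := inf [set q (x + t *: v) - t * q v | t in [set t : R | 0 <= t]].

Lemma slide_lb q v x t : sublin q -> 0 <= t -> slide q v x <= q (x + t *: v) - t * q v.
Proof.
move=> sq t0; apply: ge_inf; last by exists t.
exists (- `|x|) => _ [s s0 <-]; have [qD _ qn] := sq.
have := qD (x + s *: v) (- x); rewrite addrC addKr (sublinZ _ sq) //.
by have := qn (- x); rewrite normrN; lra.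
Qed.

Lemma slide_le q v x : sublin q -> slide q v x <= q x.
Proof.
move=> sq; have := slide_lb v x sq (lexx 0).
by rewrite scale0r addr0 mul0r subr0.
Qed.

Lemma slide_lt q v x e : sublin q -> 0 < e -> exists2 t, 0 <= t &
  q (x + t *: v) - t * q v < slide q v x + e.
Proof.
move=> sq e0.
have [|_ [t t0 <-] H] := @inf_adherent R
  [set q (x + t *: v) - t * q v | t in [set t : R | 0 <= t]] e e0.
- split; first by exists (q (x + 0 *: v) - 0 * q v); exists 0 => /=.
  exists (slide q v x) => _ [t t0 <-]; exact: slide_lb.
by exists t.
Qed.

Lemma slide_sublin q v : sublin q -> sublin (slide q v).
Proof.
move=> sq; have [qD qZ qn] := sq; split=> [x y|t x t0|x].
- apply/ler_addgt0Pr => e e0; have e2 : 0 < e / 2 by rewrite divr_gt0.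
  have [s s0 Hs] := slide_lt v x sq e2.
  have [t t0 Ht] := slide_lt v y sq e2.
  apply: le_trans (slide_lb v _ sq (addr_ge0 s0 t0)) _.
  rewrite scalerDl addrACA; have := qD (x + s *: v) (y + t *: v); lra.
- rewrite -ler_pdivrMl // mulrC; apply/ler_addgt0Pr => e e0.
  have [s s0 Hs] := slide_lt v x sq e0.
  rewrite ler_pdivrMr //.
  have ts : 0 <= t * s by rewrite mulr_ge0 // ltW.
  apply: le_trans (slide_lb v _ sq ts) _.
  rewrite -scalerA -scalerDr (sublinZ _ sq (ltW t0)) [leRHS]mulrC.
  by rewrite -[t * s * _]mulrA -mulrBr ler_pM2l // ltW.
- exact: le_trans (slide_le v x sq) (qn x).
Qed.

(** Hahn-Banach for one vector: a minimal element, given by Zorn's lemma, among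
    the sublinear functionals q below the norm with q (- v0) <= - |v0| is
    invariant under [slide] along every v, which forces it to be additive. Sliding the norm
    along v0 shows that there are such functionals. *)
Lemma exists_functional v0 : exists2 l : clin V R^o,
  (forall v, `|l v| <= `|v|) & `|v0| <= l v0.
Proof.
pose T := {q : V -> R | sublin q /\ q (- v0) <= - `|v0|}.
pose Rel (p q : T) := `[< forall x, sval q x <= sval p x >].
have sn : sublin (fun x : V => `|x|).
  split=> // [x y|t x t0]; first exact: ler_normD.
  by rewrite normrZ gtr0_norm.
have t0 : T.
  exists (slide (fun x => `|x|) v0); split; first exact: slide_sublin.
  have := slide_lb v0 (- v0) sn (ler01 : (0 : R) <= 1).
  by rewrite scale1r addNr normr0 mul1r sub0r.
have [||||[q [sq qv0]] qmax] := @Zorn T Rel.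
- by move=> t; apply/asboolP.
- move=> r s t /asboolP rs /asboolP st; apply/asboolP => x.
  exact: le_trans (st x) (rs x).
- move=> [s Ps] [t Pt] /asboolP /= st /asboolP /= ts.
  apply: eq_exist => /=; apply/funext => x.
  by apply/eqP; rewrite eq_le st ts.
- move=> A totA.
  have [[p Ap]|nA] := pselect (exists p, A p); last first.
    by exists t0 => s As; case: nA; exists s.
  pose Q x := inf [set sval q x | q in A].
  have Qlb (s : T) x : A s -> Q x <= sval s x.
    move=> As; apply: ge_inf; last by exists s.
    exists (- `|x|) => _ [r _ <-]; have [sr _] := svalP r.
    exact: sublin_ge.
  have Qad x e : 0 < e -> exists2 q, A q & sval q x < Q x + e.
    move=> e0; have [|_ [r Ar <-] H] := @inf_adherent R [set sval q x | q in A] e e0.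
    - split; first by exists (sval p x); exists p.
      by exists (Q x) => _ [r Ar <-]; exact: Qlb.
    by exists r.
  have sQ : sublin Q.
    split=> [x y|t x t1|x].
    - apply/ler_addgt0Pr => e e0; have e2 : 0 < e / 2 by rewrite divr_gt0.
      have [q Aq Hq] := Qad x _ e2; have [r Ar Hr] := Qad y _ e2.
      have [/asboolP qr|/asboolP rq] := totA _ _ Aq Ar.
        apply: le_trans (Qlb _ _ Ar) _; have [[+ _ _] _] := svalP r.
        move=> /(_ x y); have := qr x; lra.
      apply: le_trans (Qlb _ _ Aq) _; have [[+ _ _] _] := svalP q.
      move=> /(_ x y); have := rq y; lra.
    - rewrite -ler_pdivrMl // mulrC; apply/ler_addgt0Pr => e e0.
      have [q Aq Hq] := Qad x _ e0; rewrite ler_pdivrMr //.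
      apply: le_trans (Qlb _ _ Aq) _; have [[_ + _] _] := svalP q.
      move=> /(_ t x t1) /le_trans; apply.
      by rewrite [leRHS]mulrC ler_pM2l // ltW.
    - by apply: le_trans (Qlb _ _ Ap) _; have [[_ _ +] _] := svalP p; apply.
  have Qv0 : Q (- v0) <= - `|v0|.
    by apply: le_trans (Qlb _ _ Ap) _; have [_] := svalP p.
  exists (exist _ Q (conj sQ Qv0)) => s As; apply/asboolP => x /=.
  exact: Qlb.
move=> {t0 sn}; have [qD _ qn] := sq.
have qA x v : q (x + v) = q x + q v.
  apply/eqP; rewrite eq_le qD /=.
  have sv0 : slide q v (- v0) <= - `|v0| by apply: le_trans (slide_le _ _ sq) _.
  have := qmax (exist _ (slide q v) (conj (slide_sublin v sq) sv0)).
  case/(_ _)/wrap; first by apply/asboolP => y /=; exact: slide_le.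
  move=> [E]; have := slide_lb v x sq (ler01 : (0 : R) <= 1).
  by rewrite E scale1r mul1r; lra.
have qN x : q (- x) = - q x.
  by apply/eqP; rewrite -addr_eq0 -qA addNr sublin0.
have qZ t x : q (t *: x) = t * q x.
  have [t0|/ltW t0] := leP 0 t; first exact: sublinZ.
  by rewrite -[t]opprK scaleNr qN sublinZ ?oppr_ge0 // [RHS]mulNr.
have qb x : `|q x| <= `|x|.
  by rewrite ler_norml qn andbT sublin_ge.
have [l Hl] : exists l : clin V R^o, forall v, l v = q v.
  apply: (@exists_clin _ _ _ _ 1) => [a u v|v]; first by rewrite qA qZ.
  by rewrite mul1r.
exists l => [v|]; rewrite Hl //.
by have := qv0; rewrite qN lerN2.
Qed.

End Functional.

Section Cutoff.
Context {R : realType}.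

Lemma pos_part_lip (z y : R) : `|Num.max 0 z - Num.max 0 y| <= `|z - y|.
Proof.
have H1 := ler_norm (z - y); have H2 := ler_norm (y - z).
rewrite distrC in H2; rewrite ler_norml.
by case: (leP 0 z) => ?; case: (leP 0 y) => ?; apply/andP; split; lra.
Qed.

Definition sqr_pos_part (t : R^o) : R^o := (Num.max 0 t) ^+ 2.

Lemma sqr_pos_part_sd (x : R^o) : exists T, sd sqr_pos_part T x.
Proof.
have [T HT] : exists T : clin R^o R^o, forall v, T v = 2 * Num.max 0 x * v.
  apply: (@exists_clin _ R^o R^o _ (2 * Num.max 0 x)) => [a u v|v].
    by rewrite mulrDr mulrCA.
  by rewrite normrM ger0_norm // mulr_ge0 // le_max lexx.
exists T => e e0.
have [x0|x0] := leP x 0.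
  exists (e / 2); first by rewrite divr_gt0.
  move=> y z yd zd; rewrite HT (max_l x0) mulr0 mul0r subr0 /sqr_pos_part.
  have yd' : y < e / 2 by have := ler_norm (y - x); lra.
  have zd' : z < e / 2 by have := ler_norm (z - x); lra.
  rewrite subr_sqr normrM [leRHS]mulrC; apply: ler_pM => //.
    exact: pos_part_lip.
  rewrite ger0_norm ?addr_ge0 // ?le_max ?lexx //.
  have : Num.max 0 z <= e / 2 by rewrite ge_max (ltW zd') andbT; lra.
  have : Num.max 0 y <= e / 2 by rewrite ge_max (ltW yd') andbT; lra.
  lra.
exists (Num.min x (e / 2)); first by rewrite lt_min x0 divr_gt0.
move=> y z; rewrite !lt_min => /andP[yx yd] /andP[zx zd].
have pos w : `|w - x| < x -> Num.max 0 w = w.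
  rewrite distrC => wx; apply: max_r; have := ler_norm (x - w); lra.
rewrite HT /sqr_pos_part !pos //; last by rewrite subrr normr0.
rewrite (_ : _ - _ - _ = (z - y) * ((z - x) + (y - x))); last by ring.
rewrite normrM [leRHS]mulrC ler_wpM2l //; apply: le_trans (ler_normD _ _) _; lra.
Qed.

(** A C^1 step from 1 on the negative half-line to 0 beyond 1, written as a
    composition of squared positive parts so that no case analysis is needed
    to differentiate it. *)
Definition smooth_step (t : R^o) : R^o := sqr_pos_part (1 - sqr_pos_part t).

Lemma smooth_step_sd x : exists T, sd smooth_step T x.
Proof.
have [T HT] := sqr_pos_part_sd x; have [S HS] := sqr_pos_part_sd (1 - sqr_pos_part x).
have H : sd (fun t => (1 : R^o) - sqr_pos_part t) (0 - T) x.
  by apply: sdB => //; exact: sd_cst.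
by have [U _ HU] := sd_comp H HS; exists U.
Qed.

Lemma smooth_step_eq1 t : t <= 0 -> smooth_step t = 1.
Proof.
move=> t0; rewrite /smooth_step /sqr_pos_part (max_l t0) expr0n /= subr0.
by rewrite max_r ?expr1n.
Qed.

Lemma smooth_step_eq0 t : 1 <= t -> smooth_step t = 0.
Proof.
move=> t1; rewrite /smooth_step /sqr_pos_part (max_r (le_trans ler01 t1)).
have t2 : 1 <= t ^+ 2 by rewrite exprn_ege1.
by rewrite max_l ?expr0n // subr_le0.
Qed.

Definition clamp (t : R) : R := Num.min 1 (Num.max 0 t).

Lemma clamp_bounds t : 0 <= clamp t <= 1.
Proof. by rewrite /clamp le_min ge_min le_max ler01 !lexx. Qed.

Lemma clamp_lip z y : `|clamp z - clamp y| <= `|z - y|.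
Proof.
apply: le_trans _ (pos_part_lip z y); rewrite /clamp.
move: (Num.max 0 z) (Num.max 0 y) => {}z {}y.
have H1 := ler_norm (z - y); have H2 := ler_norm (y - z).
rewrite distrC in H2; rewrite ler_norml.
by case: (leP 1 z) => ?; case: (leP 1 y) => ?; apply/andP; split; lra.
Qed.

(** Expressed with the clamped variable, the step is a polynomial on [0, 1],
    from which its bounds and its Lipschitz constant can be read off. *)
Lemma smooth_step_clamp t : smooth_step t = (1 - clamp t ^+ 2) ^+ 2.
Proof.
rewrite /clamp; have [t0|t0] := leP t 0.
  by rewrite (min_r ler01) smooth_step_eq1 // expr0n subr0 expr1n.
have [t1|t1] := leP 1 t.
  by rewrite smooth_step_eq0 // expr1n subrr expr0n.
rewrite /smooth_step /sqr_pos_part (max_r (ltW t0)) max_r // subr_ge0.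
by rewrite exprn_ile1 ?ltW.
Qed.

Lemma smooth_step_bounds t : 0 <= smooth_step t <= 1.
Proof.
rewrite smooth_step_clamp; have /andP[c0 c1] := clamp_bounds t.
have c2 : 0 <= clamp t ^+ 2 <= 1 by rewrite exprn_ge0 //= exprn_ile1.
by rewrite sqr_ge0 exprn_ile1; lra.
Qed.

Lemma smooth_step_lip z y : `|smooth_step z - smooth_step y| <= 4 * `|z - y|.
Proof.
rewrite !smooth_step_clamp; apply: le_trans (ler_wpM2l _ (clamp_lip z y)) => //.
have := clamp_bounds z; have := clamp_bounds y.
move: (clamp z) (clamp y) => a b /andP[b0 b1] /andP[a0 a1].
rewrite (_ : _ - _ = (2 - a ^+ 2 - b ^+ 2) * (a + b) * (b - a)); last by ring.
rewrite !normrM (distrC b a) ler_wpM2r //.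
rewrite (_ : 4 = 2 * 2); last by ring.
have a2 : 0 <= a ^+ 2 <= 1 by rewrite exprn_ge0 //= exprn_ile1.
have b2 : 0 <= b ^+ 2 <= 1 by rewrite exprn_ge0 //= exprn_ile1.
by apply: ler_pM => //; rewrite ger0_norm; lra.
Qed.

End Cutoff.

(** The distance to S, as a multiple of a fixed vector of Y, is smoothed by
    (LA_1); a linear functional turns the result into a smooth real function
    close to the distance, to which the step is applied. The boundedness of S
    allows (LA_1), which concerns balls only, to be used: outside of a larger ball the
    cutoff is zero. *)
Lemma smooth_cutoff {R : realType} {X Y : normedModType R} (v0 : Y) : v0 != 0 ->
  property_LA X Y (Some 1%N) -> exists2 C0 : R, 0 < C0 &
  forall (S : set X) (M e : R), (forall s, S s -> `|s| <= M) -> 0 < e <= 1 ->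
  exists phi : X -> R^o, [/\ forall x, exists P, sd phi P x,
    forall x, 0 <= phi x <= 1, lip setT (C0 / e) phi,
    forall x s, S s -> `|x - s| < e / 4 -> phi x = 1 &
    forall x, phi x != 0 -> exists2 s, S s & `|x - s| < e].
Proof.
move=> v0n0 /property_LA_ball[C Cp HC].
have [l lb lv] := exists_functional v0.
have lv0 : 0 < l v0 by apply: lt_le_trans lv; rewrite normr_gt0.
have [v1 lv1] : exists v1, l v1 = 1.
  exists ((l v0)^-1 *: v0); rewrite clin_scale; apply: mulVf.
  by rewrite gt_eqF.
pose B : R := C * `|v1|.
have B0 : 0 <= B by rewrite mulr_ge0 // ltW.
exists (16 * B + 1); first by rewrite ltr_wpDl // mulr_ge0.
move=> S M e SM /andP[e0 e1].
have C0e : 1 <= (16 * B + 1) / e.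
  rewrite ler_pdivlMr // mul1r; apply: le_trans e1 _; lra.
have [[s0 Ss0]|nS] := pselect (exists s, S s); last first.
  exists (fun _ => 0); split.
  - by move=> x; exists 0; exact: sd_cst.
  - by move=> x; rewrite lexx ler01.
  - by move=> y z _ _; rewrite subrr normr0 mulr_ge0 //; lra.
  - by move=> x s Ss; case: nS; exists s.
  - by move=> x; rewrite eqxx.
have M0 : 0 <= M by apply: le_trans (SM _ Ss0).
pose dist x : R := inf [set `|x - s| | s in S].
have dist_le x s : S s -> dist x <= `|x - s|.
  by move=> Ss; apply: ge_inf; [exists 0 => _ [? _ <-]|exists s].
have dist_ad x q : dist x < q -> exists2 s, S s & `|x - s| < q.
  move=> dq; have [|_ [s Ss <-] H] := @inf_adherent R [set `|x - s| | s in S] (q - dist x)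
    ltac:(by rewrite subr_gt0).
    by split; [exists `|x - s0|; exists s0|exists 0 => _ [? _ <-]].
  by exists s => //; move: H; rewrite -/(dist x) [dist x + _]addrC subrK.
have dist_lip x y : dist x <= dist y + `|x - y|.
  apply/ler_addgt0Pr => q q0.
  have [s Ss Hs] := dist_ad y (dist y + q) ltac:(by rewrite ltrDl).
  apply: le_trans (dist_le x _ Ss) _; rewrite -(subrKA y).
  by apply: le_trans (ler_normD _ _) _; lra.
have dist_norm x : M + e <= `|x| -> e <= dist x.
  move=> xM; rewrite leNgt; apply/negP => /dist_ad[s Ss xs].
  have := ler_normD (x - s) s; rewrite subrK; have := SM _ Ss; lra.
have fl : lip (ball (0 : X) (M + 2)) `|v1| (fun x => dist x *: v1).
  move=> x y _ _; rewrite -scalerBl normrZ mulrC ler_wpM2l // ler_norml.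
  have := dist_lip x y; have := dist_lip y x; rewrite distrC.
  by move=> ? ?; apply/andP; split; lra.
have [|||g [D [gl gD fg]]] := HC 0 (M + 2) _ `|v1| (e / 8) _ _ _ fl.
- lra.
- by [].
- by rewrite divr_gt0.
pose k x : R^o := l (g x).
have kd x : ball (0 : X) (M + 2) x -> `|k x - dist x| <= e / 8.
  move=> xb; have -> : k x - dist x = l (g x - dist x *: v1).
    by rewrite (clin_sub l) clin_scale lv1 [_ *: 1]mulr1.
  by apply: le_trans (lb _) _; rewrite distrC; exact: fg.
have kl : lip (ball (0 : X) (M + 2)) B k.
  move=> x y xb yb; rewrite /k -(clin_sub l).
  by apply: le_trans (lb _) _; exact: gl.
(* k is within e / 8 of the distance: the argument of the step is negative at
   distance less than e / 4, where k < 3 e / 8, and at least 1 at distance at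
   least e, where k > 5 e / 8. *)
pose psi x : R^o := smooth_step ((4 / e) *: k x - (3 / 2 : R^o)).
pose phi x : R^o := if `|x| < M + 2 then psi x else 0.
have inb x : `|x| < M + 2 <-> ball (0 : X) (M + 2) x by rewrite in_ball subr0.
have psi1 x : ball (0 : X) (M + 2) x -> dist x < e / 4 -> psi x = 1.
  move=> /kd /ler_normlP[_ kx] dx; apply: smooth_step_eq1.
  rewrite subr_le0 -ler_pdivlMl ?divr_gt0 //.
  rewrite (_ : (4 / e)^-1 * _ = 3 / 8 * e); first by lra.
  by rewrite invf_div; lra.
have psi0 x : ball (0 : X) (M + 2) x -> e <= dist x -> psi x = 0.
  move=> /kd /ler_normlP[kx _] dx; apply: smooth_step_eq0.
  rewrite lerBrDr -ler_pdivrMl ?divr_gt0 //.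
  rewrite (_ : (4 / e)^-1 * _ = 5 / 8 * e); first by lra.
  by rewrite invf_div; lra.
have phin0 x : phi x != 0 -> ball (0 : X) (M + 2) x /\ dist x < e.
  rewrite /phi; case: ifPn => [/inb xb|_]; last by rewrite eqxx.
  move=> p0; split=> //; rewrite ltNge; apply: contra p0 => /(psi0 _ xb) ->.
  by rewrite eqxx.
have phin0_norm x : phi x != 0 -> `|x| < M + 1.
  move=> /phin0[_ xe]; rewrite ltNge; apply/negP => xM.
  have := dist_norm x; have : M + e <= `|x| by lra.
  by move=> h /(_ h); rewrite leNgt xe.
exists phi; split.
- move=> x; have [xM|xM] := ltP `|x| (M + 2); last first.
    exists 0; apply: sd_eq_near (sd_cst 0 x); exists 1 => // y yx.
    apply/esym/eqP; apply: contraT => /phin0_norm yM.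
    have := ler_normD (x - y) y; rewrite subrK distrC; lra.
  have xb : ball (0 : X) (M + 2) x by exact/inb.
  have [P1 _ H1] := sd_comp (gD _ xb) (sd_clin l (g x)).
  have H2 := sdB (sdZ (4 / e) H1) (@sd_cst R X R^o (3 / 2) x).
  have [Q HQ] := smooth_step_sd ((4 / e) *: k x - (3 / 2 : R^o)).
  have [P2 _ H3] := sd_comp H2 HQ.
  exists P2; apply: sd_eq_near H3.
  exists (M + 2 - `|x|); first by rewrite subr_gt0.
  move=> y yx; rewrite /phi ifT //=.
  have := ler_normD (y - x) x; rewrite subrK; lra.
- move=> x; rewrite /phi; case: ifP => _; first exact: smooth_step_bounds.
  by rewrite lexx ler01.
- have phib x : 0 <= phi x <= 1.
    rewrite /phi; case: ifP => _; first exact: smooth_step_bounds.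
    by rewrite lexx ler01.
  have side y z : `|y| < M + 2 -> M + 2 <= `|z| ->
      `|phi y - phi z| <= (16 * B + 1) / e * `|y - z|.
    move=> yM zM; have -> : phi z = 0 by rewrite /phi ltNge zM.
    have [->|/phin0_norm y1] := eqVneq (phi y) 0.
      by rewrite subrr normr0 mulr_ge0 //; lra.
    have /andP[p0 p1] := phib y; rewrite subr0 ger0_norm //.
    have C1 := le_trans ler01 C0e; apply: le_trans p1 _; apply: (le_trans C0e); apply: ler_peMr => //.
    have := ler_normD (z - y) y; rewrite subrK (distrC z y); lra.
  move=> y z _ _; have [yM|yM] := ltP `|y| (M + 2).
    have [zM|zM] := ltP `|z| (M + 2); last exact: side.
    rewrite /phi yM zM /psi; apply: le_trans (smooth_step_lip _ _) _.
    rewrite opprD addrACA subrr addr0 -scalerBr normrZ ger0_norm; last first.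
      by rewrite divr_ge0 // ltW.
    have kyz := kl y z ((inb y).1 yM) ((inb z).1 zM).
    apply: (@le_trans _ _ (4 * (4 / e * (B * `|y - z|)))).
      by rewrite ler_wpM2l // ler_wpM2l // divr_ge0 // ltW.
    rewrite (_ : 4 * _ = 16 * B / e * `|y - z|); last by ring.
    by rewrite ler_wpM2r // ler_wpM2r ?invr_ge0 ?ltW //; lra.
  have [zM|zM] := ltP `|z| (M + 2).
    by rewrite distrC (distrC y); exact: side.
  rewrite /phi !ltNge yM zM /= subrr normr0 mulr_ge0 //; lra.
- move=> x s Ss xs.
  have xM : `|x| < M + 2.
    have := ler_normD (x - s) s; rewrite subrK; have := SM _ Ss; lra.
  by rewrite /phi xM psi1 //; [exact/inb|exact: le_lt_trans (dist_le _ _ Ss) xs].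
- by move=> x /phin0[_ /dist_ad].
Qed.

(** * Blending a sequence of maps *)

Section Chain.
Context {R : realType} {X Y : normedModType R}.
Variable phi : nat -> X -> R^o.
Hypothesis phi01 : forall n x, 0 <= phi n x <= 1.

(** Nested convex combinations: the k-th map has weight phi k, and the maps
    after it share the remaining weight. Only the first maps matter at a point
    where some phi m equals 1, which gives local finiteness; and each nesting
    level is a combination of two maps only, which keeps the estimates sharp. *)
Fixpoint chain (h : nat -> X -> Y) (N k : nat) (y : X) : Y :=
  if N is N'.+1 then
    chain h N' k.+1 y + phi k y *: (h k y - chain h N' k.+1 y)
  else 0.

Lemma chain_stab h n m k y : phi (k + m)%N y = 1 ->
  chain h (m.+1 + n) k y = chain h m.+1 k y.
Proof.
elim: m k => [|m IH] k; first by rewrite addn0 add1n /= => ->; rewrite !scale1r !subrKC.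
by rewrite addnS -addSn => /IH; rewrite addSn /= => ->.
Qed.

(** Where the weights add up to 1, blending commutes with subtracting a map. *)
Lemma chain_sub h (F : X -> Y) N m k y : phi (k + m)%N y = 1 -> (m < N)%N ->
  chain (fun j z => h j z - F z) N k y = chain h N k y - F y.
Proof.
elim: N m k => // N IH [|m] k.
  by rewrite addn0 /= => -> _; rewrite !scale1r !subrKC.
rewrite addnS -addSn ltnS /= => p1 mN; rewrite (IH m) //.
by rewrite addrAC opprB subrKA.
Qed.

Lemma norm_convex (a b : Y) (t c : R) : 0 <= t <= 1 ->
  `|a| <= c -> `|b| <= c -> `|b + t *: (a - b)| <= c.
Proof.
move=> /andP[t0 t1] ac bc.
rewrite (_ : b + _ = (1 - t) *: b + t *: a); last first.
  by rewrite scalerBl scale1r scalerBr addrA addrAC.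
apply: le_trans (ler_normD _ _) _.
rewrite !normrZ [`|1 - t|]ger0_norm ?subr_ge0 // [`|t|]ger0_norm //.
have := ler_wpM2l t0 ac; have := ler_wpM2l (_ : 0 <= 1 - t) bc; rewrite subr_ge0.
move=> /(_ t1); lra.
Qed.

Lemma chain_bound (u : nat -> X -> Y) N k y (c : R) : 0 <= c ->
  (forall j, (k <= j)%N -> phi j y != 0 -> `|u j y| <= c) ->
  `|chain u N k y| <= c.
Proof.
move=> c0; elim: N k => [|N IH] k H /=; first by rewrite normr0.
have IH' : `|chain u N k.+1 y| <= c by apply: IH => j /ltnW; exact: H.
have [->|p0] := eqVneq (phi k y) 0; first by rewrite scale0r addr0.
by apply: norm_convex => //; exact: H.
Qed.

Lemma chain_near h F0 m k y (c : R) : 0 <= c -> phi (k + m)%N y = 1 ->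
  (forall j, (k <= j)%N -> phi j y != 0 -> `|h j y - F0| <= c) ->
  `|chain h m.+1 k y - F0| <= c.
Proof.
move=> c0 p1 H; rewrite -(@chain_sub h (fun _ => F0) _ m) //.
exact: chain_bound.
Qed.

Variables (l eps : nat -> R) (delta : R).
Hypothesis l_ge0 : forall n, 0 <= l n.
Hypothesis eps_ge0 : forall n, 0 <= eps n.
Hypothesis eps_anti : forall m n, (m <= n)%N -> eps n <= eps m.
Hypothesis delta0 : 0 <= delta.
Hypothesis budget : forall n, 2 * l n * eps n <= delta * 2^-1 ^+ n.+1.
Hypothesis phi_lip : forall n, lip setT (l n) (phi n).

Let geoS n : delta * 2^-1 ^+ n = delta * 2^-1 ^+ n.+1 + delta * 2^-1 ^+ n.+1.
Proof. by rewrite exprS; lra. Qed.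

(** Each level combines two maps whose increments are bounded by c and whose
    values differ by at most 2 eps k: the weight contributes at most
    l k * 2 eps k to the Lipschitz constant, and these contributions sum to
    delta. When only one of the two points is in the support of phi k, the
    map u k enters through this difference of weights alone. *)
Lemma chain_lip (u : nat -> X -> Y) (B : set X) (c : R) N k : 0 <= c ->
  (forall j y, B y -> phi j y != 0 -> `|u j y| <= eps j) ->
  (forall j y z, B y -> B z -> phi j y != 0 -> phi j z != 0 ->
     `|u j y - u j z| <= c * `|y - z|) ->
  lip B (c + delta * 2^-1 ^+ k) (chain u N k).
Proof.
move=> c0 Hb Hl; elim: N k => [|N IH] k y z By Bz.
  rewrite /= subrr normr0 mulr_ge0 // addr_ge0 // mulr_ge0 // exprn_ge0 //.
  by lra.
have cb w : B w -> `|chain u N k.+1 w| <= eps k.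
  move=> Bw; apply: chain_bound => // j kj p0.
  by apply: le_trans (Hb _ _ Bw p0) _; apply: eps_anti; exact: ltnW.
(* By symmetry, only pairs whose first point is in the support matter. *)
have main y' z' : B y' -> B z' -> phi k y' != 0 ->
    `|chain u N.+1 k y' - chain u N.+1 k z'| <= (c + delta * 2^-1 ^+ k) * `|y' - z'|.
  move=> {By Bz y z} By Bz py /=.
  have b0 := IH k.+1 _ _ By Bz.
  have pl : `|phi k y' - phi k z'| <= l k * `|y' - z'| by exact: phi_lip.
  have := cb _ By; have := b0; move: (chain u N k.+1) => b bl be.
  have -> : b y' + phi k y' *: (u k y' - b y') - (b z' + phi k z' *: (u k z' - b z')) =
   ((b y' - b z') + phi k z' *: ((u k y' - u k z') - (b y' - b z')))
   + (phi k y' - phi k z') *: (u k y' - b y').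
    have E (p q P Q W : Y) : p + P - (q + Q) = p - q + (W - Q) + (P - W).
      rewrite !opprD !addrA [RHS](ACl (1*5*2*4*(3*6))) /=.
      by rewrite subrr addr0.
    rewrite [(phi k y' - _) *: _]scalerBl (_ : u k y' - u k z' - _ =
      (u k y' - b y') - (u k z' - b z')).
      by rewrite [_ *: (_ - (_ - b z'))]scalerBr; exact: E.
    by rewrite !opprB !addrA [LHS](ACl (1*4*3*2)).
  apply: le_trans (ler_normD _ _) _; rewrite geoS addrA mulrDl; apply: lerD.
    have [->|pz] := eqVneq (phi k z') 0; first by rewrite scale0r addr0.
    apply: norm_convex => //; apply: le_trans (Hl _ _ _ By Bz py pz) _.
    by rewrite ler_wpM2r // lerDl mulr_ge0 // exprn_ge0 // invr_ge0.
  rewrite normrZ; apply: (@le_trans _ _ (l k * `|y' - z'| * (2 * eps k))).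
    apply: ler_pM => //; apply: le_trans (ler_normB _ _) _.
    by have := Hb _ _ By py; lra.
  have := ler_wpM2r (normr_ge0 (y' - z')) (budget k); lra.
have [py|py] := eqVneq (phi k y) 0; last exact: main.
have [pz|pz] := eqVneq (phi k z) 0; last by rewrite distrC (distrC y); exact: main.
rewrite /= py pz !scale0r !addr0; apply: le_trans (IH k.+1 _ _ By Bz) _.
rewrite ler_wpM2r // lerD2l [leRHS]geoS lerDl mulr_ge0 // exprn_ge0 //.
by rewrite invr_ge0.
Qed.

(** The infinitesimal counterpart of [chain_lip]. The derivative of a
    combination of two maps is the combination of their derivatives, plus the
    derivative of the weight times the difference of their values; the latter
    is small at x when all the active values are close to F0. *)
Lemma chain_sd (h : nat -> X -> Y) (D : nat -> clin X Y) (x : X) m k :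
  (forall j, exists P, sd (phi j) P x) ->
  (forall j, (exists2 d : R, 0 < d & forall y, `|y - x| < d -> phi j y = 0) \/
     sd (h j) (D j) x) ->
  (exists2 d : R, 0 < d & forall y, `|y - x| < d -> phi (k + m)%N y = 1) ->
  exists2 T : clin X Y, sd (chain h m.+1 k) T x &
   forall F0 (G : clin X Y) c, 0 <= c ->
     (forall j, (exists2 d : R, 0 < d & forall y, `|y - x| < d -> phi j y = 0) \/
        (`|h j x - F0| <= eps j /\ `|D j - G| <= c)) ->
     `|T - G| <= c + delta * 2^-1 ^+ k.
Proof.
move=> phiD hD.
have geo0 n : 0 <= delta * 2^-1 ^+ n by rewrite mulr_ge0 // exprn_ge0 // invr_ge0.
have z0 j : (exists2 d : R, 0 < d & forall y, `|y - x| < d -> phi j y = 0) ->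
    phi j x = 0.
  by move=> [d d0]; apply; rewrite subrr normr0.
elim: m k => [|m IH] k.
  rewrite addn0 => -[d d0 p1]; exists (D k).
    case: (hD k) => [/z0|]; last first.
      apply: sd_eq_near; exists d => // y /p1 /= ->.
      by rewrite scale1r !subrKC.
    by rewrite p1 ?subrr ?normr0 // => /eqP; rewrite oner_eq0.
  move=> F0 G c c0 /(_ k)[/z0|[_ DG]].
    by rewrite p1 ?subrr ?normr0 // => /eqP; rewrite oner_eq0.
  by apply: le_trans DG _; rewrite lerDl.
rewrite addnS -addSn => p1; have [T HT TG] := IH _ p1.
have [d d0 p1'] := p1.
have p1x : phi (k.+1 + m)%N x = 1 by apply: p1'; rewrite subrr normr0.
have [[r r0 pk0]|hk] := hD k.
  exists T.
    apply: sd_eq_near HT; exists r => // y /pk0 pk /=.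
    by rewrite pk scale0r addr0.
  move=> F0 G c c0 H; apply: le_trans (TG F0 G c c0 H) _.
  by rewrite [in leRHS]geoS addrA lerDl.
have [P HP] := phiD k.
have [Q QE HQ] := sd_scale HP (sdB hk HT).
exists (T + Q); first exact: sdD.
move=> F0 G c c0 H.
case: (H k) => [[r r0 pk0]|[hF DG]].
  have -> : Q = 0.
    apply/eqP; rewrite -normr_le0.
    apply: (sd_norm_le (lexx 0) HQ); exists r => // y z; rewrite !in_ball => yx zx.
    by rewrite !pk0 // !scale0r subrr normr0 mul0r.
  rewrite addr0; apply: le_trans (TG F0 G c c0 H) _.
  by rewrite [in leRHS]geoS addrA lerDl.
have cF : `|chain h m.+1 k.+1 x - F0| <= eps k.
  apply: chain_near => // j kj pj; case: (H j) => [/z0/eqP|[hj _]].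
    by rewrite (negbTE pj).
  by apply: le_trans hj _; apply: eps_anti; exact: ltnW.
have Pl : `|P| <= l k.
  by apply: (sd_norm_le (l_ge0 k) HP); exists 1 => // y z _ _; exact: phi_lip.
apply: clin_norm_le => [|v]; first by rewrite addr_ge0.
rewrite clinB clinD QE clinB.
have -> : T v + (phi k x *: (D k v - T v) + P v *: (h k x - chain h m.+1 k.+1 x)) - G v
  = ((T - G) v + phi k x *: ((D k - G) v - (T - G) v)) + P v *: (h k x - chain h m.+1 k.+1 x).
  by rewrite !clinB opprB subrKA addrA [LHS](ACl (1*4*2*3)).
rewrite geoS addrA mulrDl; apply: le_trans (ler_normD _ _) _; apply: lerD.
  apply: norm_convex => //; apply: le_trans (clin_le _ _) _; rewrite ler_wpM2r //.
    by apply: le_trans DG _; rewrite lerDl.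
  exact: TG H.
rewrite normrZ; apply: (@le_trans _ _ (l k * `|v| * (2 * eps k))).
  apply: ler_pM => //.
    by apply: le_trans (clin_le _ _) _; rewrite ler_wpM2r.
  by rewrite -(subrKA F0) -(opprB (chain _ _ _ _)); apply: le_trans (ler_normB _ _) _; lra.
have := ler_wpM2r (normr_ge0 v) (budget k); lra.
Qed.

End Chain.

(** * A sigma-discrete refinement of a cover by balls *)

Lemma strict_well_order (T : eqType) : exists Lt : T -> T -> Prop,
  [/\ forall a b, a <> b -> Lt a b \/ Lt b a &
      forall P : T -> Prop, (exists a, P a) ->
        exists2 a, P a & forall b, Lt b a -> ~ P b].
Proof.
have [Le wo] := @well_ordering_principle T.
have anti a b : Le a b -> Le b a -> a = b.
  move=> ab ba; have Lee c : Le c c.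
    have [|d [[dc dmin] _]] := wo (pred1 c); first by exists c; rewrite inE.
    by move: dc dmin; rewrite inE => /eqP -> /(_ c); rewrite inE => /(_ (eqxx c)).
  have [|d [_ dU]] := wo (pred2 a b); first by exists a; rewrite !inE eqxx.
  rewrite -(dU a) ?(dU b) //; split; rewrite ?inE ?eqxx ?orbT //;
    by move=> c; rewrite !inE => /orP[]/eqP ->.
exists (fun a b => Le a b /\ a <> b); split.
  move=> a b ab; have [|d [[dab dmin] _]] := wo (pred2 a b).
    by exists a; rewrite !inE eqxx.
  move: dab; rewrite !inE => /orP[]/eqP E; rewrite {}E in dmin.
    by left; split=> //; apply: dmin; rewrite !inE eqxx orbT.
  by right; split; [apply: dmin; rewrite !inE eqxx|exact/nesym].
move=> P [a Pa].
have [|d [[dP dmin] _]] := wo [pred x | `[< P x >]].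
  by exists a; apply/asboolP.
exists d; first by apply/asboolP.
move=> b [bd nbd] Pb; apply: nbd; apply: anti => //.
by apply: dmin; apply/asboolP.
Qed.

(** Stone's construction. With rho a y = r a - |y - a|, which is positive on
    the ball around a only and 1-Lipschitz, S n a consists of the points at
    which rho a >= 2^-n while rho b <= 2^-(n+1) for all b before a in a
    well-ordering of X. The gap between these two bounds separates S n a from
    S n b. Every y is covered by the first ball that contains it. *)
Lemma sigma_discrete {R : realType} {X : normedModType R} (r : X -> R) :
  (forall x, 0 < r x) -> exists S : nat -> X -> set X,
  [/\ forall n a y, S n a y -> 2^-1 ^+ n <= r a - `|y - a|,
      forall n a y, S n a y -> `|y| <= n%:R,
      forall n a b y z, S n a y -> S n b z -> a <> b ->
        2^-1 ^+ n.+1 <= `|y - z| &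
      forall y, exists n a, S n a y].
Proof.
move=> r0; have [Lt [Lt_total Lt_wf]] := strict_well_order X.
pose rho a (y : X) := r a - `|y - a|.
pose S n a y := [/\ 2^-1 ^+ n <= rho a y, `|y| <= n%:R &
  forall b, Lt b a -> rho b y <= 2^-1 ^+ n.+1].
have rho_lip a (y z : X) : rho a y <= rho a z + `|y - z|.
  rewrite /rho; have := ler_normD (z - y) (y - a).
  by rewrite subrKA (distrC z y); lra.
have sep n a b y z : S n a y -> S n b z -> Lt a b -> 2^-1 ^+ n.+1 <= `|y - z|.
  move=> [ay _ _] [_ _ bz] /bz az; have := rho_lip a y z.
  by move: ay; rewrite exprS in az *; lra.
exists S; split=> [n a y []//|n a y []//|n a b y z ay bz /Lt_total[ab|ba]|y].
- exact: sep ay bz ab.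
- by rewrite distrC; exact: sep bz ay ba.
have [|a ya amin] := Lt_wf (fun a => 0 < rho a y).
  by exists y; rewrite /rho subrr normr0 subr0.
have [n Hn] := exists_geo_lt 1 ya; have [m ym] : exists m : nat, `|y| <= m%:R.
  exists (Num.bound `|y|); exact/ltW/archi_boundP.
have h0 k : (0 : R) < 2^-1 ^+ k by rewrite exprn_gt0 // invr_gt0.
exists (maxn n m), a; split.
- rewrite mul1r in Hn; apply: le_trans (ltW Hn).
  by apply: ler_wiXn2l; rewrite ?leq_maxl //; lra.
- by apply: le_trans ym _; rewrite ler_nat leq_maxr.
- by move=> b /amin /negP; rewrite -leNgt => /le_trans; apply; exact: ltW.
Qed.

(** * Gluing smooth pieces *)

(** For a fixed n the pieces around the sets S n a do not interfere, since
    these sets are uniformly separated; together they form one map h n, smooth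
    near the support of a cutoff phi n of the union of the S n a. The maps h n
    are blended by [chain], where the n-th one uses the pieces p a (eps n) with
    eps n small compared with both the separation of the S n a and the inverse
    of the Lipschitz constant of phi n. *)
Lemma smooth_gluing {R : realType} {X Y : normedModType R} (v0 : Y) : v0 != 0 ->
  property_LA X Y (Some 1%N) ->
  forall (r : X -> R) (p : X -> R -> X -> Y) (Dp : X -> R -> X -> clin X Y)
    (delta : R),
  (forall x, 0 < r x) -> 0 < delta ->
  (forall x e y, 0 < e -> ball x (r x) y -> sd (p x e) (Dp x e y) y) ->
  exists h Dh, [/\ forall x, sd h (Dh x) x,
    forall y F0, (forall x e, 0 < e -> ball x (r x) y -> p x e y = F0) ->
      h y = F0,
    forall (B : set X) (F : X -> Y) c, 0 <= c ->
      (forall x e, 0 < e ->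
         lip (B `&` ball x (r x)) c (fun y => p x e y - F y) /\
         forall y, B y -> ball x (r x) y -> `|p x e y - F y| <= e) ->
      lip B (c + delta) (fun y => h y - F y) &
    forall a F0 (G : clin X Y) c, 0 <= c ->
      (forall x e, 0 < e -> ball x (r x) a ->
         `|p x e a - F0| <= e /\ `|Dp x e a - G| <= c) ->
      `|Dh a - G| <= c + delta].
Proof.
move=> v0n0 LA r p Dp delta r0 delta0 pD.
have [C0 C00 cut] := smooth_cutoff v0n0 LA.
have [S [Srho Snorm Ssep Scov]] := sigma_discrete r0.
pose q n : R := 2^-1 ^+ n.
have q0 n : 0 < q n by rewrite exprn_gt0 // invr_gt0.
have qS n : q n = 2 * q n.+1 by rewrite /q exprS; lra.
have q1 n : q n <= 1 by apply: exprn_ile1; lra.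
have q_anti m n : (m <= n)%N -> q n <= q m.
  by move=> mn; apply: ler_wiXn2l => //; lra.
(* The neighbourhood of S n a on which the n-th map is a piece around a: its
   width q n / 8 leaves the gap q n / 4 = q n / 2 - 2 (q n / 8) between
   different a. *)
pose V n a y := exists2 s, S n a s & `|y - s| < q n / 8.
have V_uniq n a b y : V n a y -> V n b y -> a = b.
  move=> [s Ss ys] [t St yt]; apply: contrapT => /(Ssep _ _ _ _ _ Ss St).
  have := ler_normB (y - s) (y - t); rewrite opprB [y - s + _]addrC subrKA.
  rewrite distrC -/(q n.+1); have := qS n; have := q0 n; lra.
have V_sep n a b y z : V n a y -> V n b z -> a <> b -> q n / 4 <= `|y - z|.
  move=> [s Ss ys] [t St zt] /(Ssep _ _ _ _ _ Ss St).
  rewrite -/(q n.+1) -(subrKA y) -[y - t](subrKA z).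
  have := ler_normD (s - y) (y - z + (z - t)); have := ler_normD (y - z) (z - t).
  by rewrite (distrC s); have := qS n; lra.
have V_ball n a y : V n a y -> ball a (r a) y.
  move=> [s /Srho Ss ys]; rewrite in_ball -(subrKA s).
  by apply: le_lt_trans (ler_normD _ _) _; have := q0 n; rewrite -/(q n) in Ss; lra.
have V_open n a x : V n a x ->
    exists2 d : R, 0 < d & forall y, `|y - x| < d -> V n a y.
  move=> [s Ss xs]; exists (q n / 8 - `|x - s|); first by rewrite subr_gt0.
  move=> y yx; exists s => //; rewrite -(subrKA x).
  by apply: le_lt_trans (ler_normD _ _) _; lra.
have /choice[idx idxP] n : exists f : X -> X, forall y a, V n a y -> f y = a.
  have /choice[f Hf] y : exists a, forall b, V n b y -> a = b.
    have [[a Va]|nV] := pselect (exists a, V n a y).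
      by exists a => b; exact: V_uniq.
    by exists 0 => b Vb; case: nV; exists b.
  by exists f.
have /choice[phi phiP] n := cut [set s | exists a, S n a s] n%:R (q n / 16)
  (fun s '(ex_intro a Sas) => Snorm n a s Sas)
  ltac:(by apply/andP; split; [rewrite divr_gt0|have := q1 n; have := q0 n; lra]).
have phi01 n x : 0 <= phi n x <= 1 by case: (phiP n).
pose l n := C0 / (q n / 16).
have l0 n : 0 <= l n by rewrite ltW // divr_gt0 // divr_gt0.
have phi_lip n : lip setT (l n) (phi n) by case: (phiP n).
have phi_V n x : phi n x != 0 -> exists2 s, (exists a, S n a s) & `|x - s| < q n / 16.
  by case: (phiP n) => _ _ _ _; exact.
have phi_V' n x : phi n x != 0 -> exists a, V n a x.
  move=> /phi_V[s [a Sa] xs]; exists a, s => //.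
  by apply: lt_le_trans xs _; have := q0 n; lra.
(* The cutoffs have slopes of order C0 / q n and the gaps are of order q n, so
   errors of order (q n)^2 contribute a geometric series. *)
have [k k0 kC] : exists2 k, 0 < k & 256 * (k * (C0 + 1)) = delta.
  have C1 : 0 < 256 * (C0 + 1) by rewrite mulr_gt0 // ltr_wpDl // ltW.
  exists (delta / (256 * (C0 + 1))); first by rewrite divr_gt0.
  by rewrite mulrCA divfK // gt_eqF.
have kC0 : 0 < k * C0 by rewrite mulr_gt0.
pose eps n := k * q n * q n.
have eps0 n : 0 < eps n by exact: mulr_gt0 (mulr_gt0 k0 (q0 n)) (q0 n).
have eps_anti m n : (m <= n)%N -> eps n <= eps m.
  move=> mn; rewrite /eps -!mulrA ler_pM2l //.
  by apply: ler_pM; [exact/ltW/q0|exact/ltW/q0|exact: q_anti|exact: q_anti].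
have budget n : 2 * l n * eps n <= delta / 2 * 2^-1 ^+ n.+1.
  rewrite -/(q n.+1) /l /eps invf_div.
  have := q0 n; have := qS n; move: (q n) (q n.+1) => a b ab a0.
  rewrite (_ : 2 * (C0 * (16 / a)) * (k * a * a) = 32 * (k * C0) * a * (a / a)).
    rewrite divff ?gt_eqF // mulr1 ab; have b0 : 0 < b by lra.
    have := mulr_gt0 kC0 b0; have := mulr_gt0 k0 b0.
    by rewrite -kC; lra.
  by ring.
pose h n y := p (idx n y) (eps n) y.
pose D n y := Dp (idx n y) (eps n) y.
have h_near n a x : V n a x -> sd (h n) (D n x) x.
  move=> Vx; rewrite /D (idxP _ _ _ Vx); have [d d0 Hd] := V_open _ _ _ Vx.
  apply: sd_eq_near (pD a (eps n) x _ _) => //; last exact: V_ball Vx.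
  by exists d => // y /Hd Vy; rewrite /h (idxP _ _ _ Vy).
have phi_cases n x : (exists2 d : R, 0 < d & forall y, `|y - x| < d -> phi n y = 0) \/
    exists a, V n a x.
  have [|nV] := pselect (exists a, V n a x); first by right.
  left; exists (q n / 16); first by rewrite divr_gt0.
  move=> y yx; apply/eqP; apply: contraT => /phi_V[s [a Sa] ys]; case: nV.
  exists a, s => //; rewrite -(subrKA y); apply: le_lt_trans (ler_normD _ _) _.
  by rewrite (distrC x); lra.
have /choice[m mP] x : exists m,
    exists2 d : R, 0 < d & forall y, `|y - x| < d -> phi m y = 1.
  have [n [a Sx]] := Scov x; exists n, (q n / 16 / 4); first by rewrite !divr_gt0.
  move=> y yx; case: (phiP n) => _ _ _ + _; apply; [|exact: yx].
  by exists a.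
pose H x := chain phi h (m x).+1 0 x.
have phim x : phi (0 + m x)%N x = 1.
  by rewrite add0n; have [d d0] := mP x; apply; rewrite subrr normr0.
have HE N n x : phi n x = 1 -> (n < N)%N -> chain phi h N 0 x = H x.
  move=> pn nN.
  have EE i : phi i x = 1 -> forall M, (i < M)%N -> chain phi h M 0 x = chain phi h i.+1 0 x.
    move=> pi M iM; rewrite -(subnK iM) addnC; apply: chain_stab => //.
  rewrite /H (EE _ pn _ nN).
  have pm := phim x; rewrite add0n in pm.
  by rewrite -(EE _ pn (maxn n (m x)).+1) ?ltnS ?leq_maxl // (EE _ pm) // ltnS leq_maxr.
have d20 : 0 <= delta / 2 by rewrite divr_ge0 // ltW.
have eps_ge0 n : 0 <= eps n by exact/ltW/eps0.
have /choice[DH DHP] x : exists T : clin X Y, sd H T x /\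
   forall F0 (G : clin X Y) c, 0 <= c ->
     (forall j, (exists2 d : R, 0 < d & forall y, `|y - x| < d -> phi j y = 0) \/
        (`|h j x - F0| <= eps j /\ `|D j x - G| <= c)) ->
     `|T - G| <= c + delta.
  have [||T HT TG] := @chain_sd R X Y phi phi01 l eps (delta / 2) l0 eps_ge0
    eps_anti d20 budget phi_lip h (fun n => D n x) x (m x) 0 _ _ (mP x).
  - by move=> j; case: (phiP j).
  - move=> j; have [|[a Va]] := phi_cases j x; [by left|right; exact: h_near Va].
  exists T; split.
    have [d d0 Hd] := mP x; apply: sd_eq_near HT; exists d => // y yx.
    by apply: HE (Hd y yx) _.
  move=> F0 G c c0 /(TG _ _ _ c0) /le_trans; apply.
  by rewrite expr0 mulr1 lerD2l; lra.
exists H, DH; split.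
- by move=> x; have [] := DHP x.
- move=> y F0 pF; apply/eqP; rewrite -subr_eq0 -normr_le0.
  apply: chain_near => // j _ /phi_V'[a Va].
  by rewrite /h (idxP _ _ _ Va) pF ?subrr ?normr0 //; exact: V_ball Va.
- move=> B F c c0 HB y z By Bz.
  pose N := (maxn (m y) (m z)).+1.
  have pmy := phim y; have pmz := phim z.
  have HN w : B w -> phi (0 + m w)%N w = 1 -> (m w < N)%N ->
     H w - F w = chain phi (fun j z => h j z - F z) N 0 w.
    move=> Bw pw mw; rewrite (chain_sub _ _ pw mw); congr (_ - _).
    by apply/esym; apply: HE mw.
  rewrite !HN // ?ltnS ?leq_maxl ?leq_maxr //.
  have := @chain_lip R X Y phi phi01 l eps (delta / 2) eps_ge0
    eps_anti d20 budget phi_lip (fun j z => h j z - F z) B (c + delta / 2) N 0%N.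
  rewrite expr0 mulr1 -addrA -splitr; apply => //; first by rewrite addr_ge0.
    move=> j w Bw /phi_V'[a Va]; rewrite /h (idxP _ _ _ Va).
    by have [_] := HB a _ (eps0 j); apply=> //; exact: V_ball Va.
  move=> j w w' Bw Bw' /phi_V'[a Va] /phi_V'[b Vb].
  rewrite /h (idxP _ _ _ Va) (idxP _ _ _ Vb).
  have [ab|ab] := eqVneq a b.
    rewrite -ab in Vb *; have [+ _] := HB a _ (eps0 j).
    move=> /(_ w w') HL; apply: le_trans (HL _ _) _.
    - by split=> //; exact: V_ball Va.
    - by split=> //; exact: V_ball Vb.
    by rewrite ler_wpM2r // lerDl.
  have sep := V_sep _ _ _ _ _ Va Vb (elimN eqP ab).
  have [_ /(_ w Bw (V_ball _ _ _ Va)) Ha] := HB a _ (eps0 j).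
  have [_ /(_ w' Bw' (V_ball _ _ _ Vb)) Hb] := HB b _ (eps0 j).
  apply: le_trans (ler_normB _ _) _.
  have : c * `|w - w'| >= 0 by rewrite mulr_ge0.
  have : delta / 2 * (q j / 4) <= delta / 2 * `|w - w'| by rewrite ler_wpM2l.
  have : eps j <= k * q j.
    rewrite /eps; apply: ler_piMr; last exact: q1.
    by rewrite mulr_ge0 // ltW.
  have := mulr_gt0 kC0 (q0 j); have := mulr_gt0 k0 (q0 j).
  rewrite -kC; lra.
- move=> a F0 G c c0 HG; have [_ /(_ F0 G c c0)] := DHP a; apply=> j.
  have [|[b Vb]] := phi_cases j a; [by left|right].
  by rewrite /h /D (idxP _ _ _ Vb); apply: HG => //; exact: V_ball Vb.
Qed.

(** * Approximating a map together with its derivative *)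

(** Condition (W) with the continuity of G spelled out. *)
Definition whitney_pair {R : realType} {X Y : normedModType R} (A : set X)
    (f : X -> Y) (G : X -> clin X Y) :=
  (forall a e, A a -> 0 < e -> exists2 d : R, 0 < d &
     forall y, A y -> `|y - a| < d -> `|G y - G a| <= e) /\
  (forall a, A a -> strict_derivative A f (G a) a).

Section Approximation.
Context {R : realType} {X Y : normedModType R}.
Implicit Types (A : set X) (f : X -> Y) (G : X -> clin X Y).

Lemma ball_min (x y : X) (d r : R) : ball x (Num.min d r) y ->
  ball x d y /\ ball x r y.
Proof. by rewrite !in_ball lt_min => /andP. Qed.

Lemma condition_W_pair A f G : condition_W A f G -> whitney_pair A f G.
Proof.
move=> [Gc Gs]; split=> // a e Aa e0.
have Gca := (subspace_continuousP A G).1 Gc a Aa.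
have /cvgrPdistC_le/(_ _ e0) := Gca.
rewrite /prop_near1 /within /= => /nbhs_ballP[d /= d0 Hd].
by exists d => // y Ay; rewrite -in_ball => /Hd; exact.
Qed.

Lemma whitney_pair_subset A B f G : B `<=` A -> whitney_pair A f G -> whitney_pair B f G.
Proof.
move=> BA [Gc Gs]; split=> [a e /BA Aa /(Gc _ _ Aa)[d d0 Hd]|a /BA /Gs H e /H[d d0 Hd]].
  by exists d => // y /BA; exact: Hd.
by exists d => // y z /BA Ay /BA Az; exact: Hd.
Qed.

(** This is what allows the approximation step to be iterated. *)
Lemma whitney_pairB A f G h (Dh : X -> clin X Y) : whitney_pair A f G ->
  (forall x, sd h (Dh x) x) -> whitney_pair A (fun y => f y - h y) (fun y => G y - Dh y).
Proof.
move=> [Gc Gs] hD; split=> [a e Aa e0|a Aa e e0].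
  have e20 : 0 < e / 2 by rewrite divr_gt0.
  have [d d0 Hd] := Gc a _ Aa e20.
  have [r r0 Hr] := sd_derivative_continuous hD a e20.
  exists (Num.min d r) => [|y Ay]; first by rewrite lt_min d0.
  rewrite lt_min => /andP[yd yr].
  rewrite (_ : _ - _ - _ = (G y - G a) - (Dh y - Dh a)); last first.
    by rewrite !opprD !opprK !addrA [LHS](ACl (1*3*2*4)).
  apply: le_trans (ler_normB _ _) _.
  by have := Hd _ Ay yd; have := Hr _ yr; lra.
have e20 : 0 < e / 2 by rewrite divr_gt0.
have [d d0 Hd] := Gs a Aa _ e20.
have [r r0 Hr] := sd_strict A (hD a) e20.
exists (Num.min d r) => [|y z Ay Az]; first by rewrite lt_min d0.
move=> /ball_min[yd yr] /ball_min[zd zr].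
rewrite clinB (_ : _ - _ - _ = (f z - f y - G a (z - y)) - (h z - h y - Dh a (z - y))).
  apply: le_trans (ler_normB _ _) _.
  have := Hd _ _ Ay Az yd zd; have := Hr _ _ Ay Az yr zr; lra.
by rewrite !opprD !opprK !addrA [LHS](ACl (1*3*5*2*4*6)).
Qed.

Lemma lip_le (B : set X) (c c' : R) f : c <= c' -> lip B c f -> lip B c' f.
Proof.
move=> cc H y z By Bz; apply: le_trans (H _ _ By Bz) _.
by rewrite ler_wpM2r.
Qed.

Lemma lipD (B : set X) (c c' : R) f g :
  lip B c f -> lip B c' g -> lip B (c + c') (fun y => f y + g y).
Proof.
move=> Hf Hg y z By Bz; rewrite opprD addrACA mulrDl.
by apply: le_trans (ler_normD _ _) _; apply: lerD; [exact: Hf|exact: Hg].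
Qed.

Lemma lip_ext (B : set X) (c : R) f g : (forall y, B y -> f y = g y) ->
  lip B c f -> lip B c g.
Proof. by move=> fg H y z By Bz; rewrite -!fg ?H. Qed.

Lemma closed_ball_disjoint A x : closed A -> ~ A x ->
  exists2 d : R, 0 < d & forall y, ball x d y -> ~ A y.
Proof.
move=> cA nAx; have : nbhs x (~` A).
  by apply: open_nbhs_nbhs; split=> //; rewrite openC.
by move=> /nbhs_ballP[d /= d0 Hd]; exists d.
Qed.

Lemma property_LE_lip : property_LE X Y -> exists2 C : R, 0 < C &
  forall (A : set X) f (L : R), 0 <= L -> lip A L f ->
    exists g, (forall x, A x -> g x = f x) /\ lip setT (C * L) g.
Proof.
move=> [C C0 H]; exists C => // A f L L0 /lipP Lf.
by have [g [gf /lipP gL]] := H A f L L0 Lf; exists g.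
Qed.

(** Choice of radii and pieces, in the form required by [smooth_gluing]. *)
Lemma glue_pieces (P : X -> R -> R -> (X -> Y) -> (X -> clin X Y) -> Prop) :
  (forall x, exists2 rho : R, 0 < rho & forall e, 0 < e -> exists p D, P x rho e p D) ->
  exists r p Dp, (forall x, 0 < r x) /\
    forall x e, 0 < e -> P x (r x) e (p x e) (Dp x e).
Proof.
move=> H.
have /choice[r Hr] x : exists rho : R, 0 < rho /\
    forall e, 0 < e -> exists p D, P x rho e p D.
  by have [rho r0 Hrho] := H x; exists rho.
have /choice[pD HpD] (xe : X * R) : exists pD : (X -> Y) * (X -> clin X Y),
    0 < xe.2 -> P xe.1 (r xe.1) xe.2 pD.1 pD.2.
  have [e0|e0] := ltP 0 xe.2; last first.
    by exists (fun=> 0, fun=> 0).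
  by have [p [D pD]] := (Hr xe.1).2 _ e0; exists (p, D).
exists r, (fun x e => (pD (x, e)).1), (fun x e => (pD (x, e)).2); split.
  by move=> x; have [] := Hr x.
by move=> x e e0; exact: (HpD (x, e)).
Qed.

(** Near a point x of A the map f - G x is e0-Lipschitz on A; the piece at x is
    G x plus a smooth approximation of a Lipschitz extension of f - G x. It
    differs from f, and its derivative differs from G, by multiples of e0, and
    [smooth_gluing] preserves both. Off A the pieces are zero, on balls that do
    not meet A. *)
Lemma approx_derivative (v0 : Y) A f G eta : v0 != 0 ->
  property_LE X Y -> property_LA X Y (Some 1%N) -> closed A -> whitney_pair A f G ->
  0 < eta -> exists h Dh, [/\ forall x, sd h (Dh x) x,
    lip A eta (fun y => h y - f y) & forall a, A a -> `|Dh a - G a| <= eta].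
Proof.
move=> v0n0 /property_LE_lip[C1 C10 LE] LA cA [Gc Gs] eta0.
have [C2 C20 LAb] := property_LA_ball LA.
(* One unit of e0 for the variation of G, C1 for the Lipschitz extension and
   C2 C1 for its smooth approximation; the other half of eta is spent by the
   gluing. *)
pose e0 := eta / 2 / (1 + C1 + C2 * C1).
have C12 : 0 < C2 * C1 by rewrite mulr_gt0.
have CC0 : 0 < 1 + C1 + C2 * C1 by lra.
have e00 : 0 < e0 by rewrite divr_gt0 // divr_gt0.
have e0E : e0 + C1 * e0 + C2 * (C1 * e0) = eta / 2.
  rewrite (_ : _ + _ = e0 * (1 + C1 + C2 * C1)); last by ring.
  by rewrite /e0 divfK // gt_eqF.
have C1e : 0 < C1 * e0 by rewrite mulr_gt0.
have C2e : 0 < C2 * (C1 * e0) by rewrite mulr_gt0.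
pose P (x : X) (rho e : R) (p : X -> Y) (D : X -> clin X Y) :=
  [/\ forall y, ball x rho y -> sd p (D y) y,
      forall y, A y -> ball x rho y -> `|p y - f y| <= e,
      lip (A `&` ball x rho) (eta / 2) (fun y => p y - f y) &
      forall y, A y -> ball x rho y -> `|D y - G y| <= eta / 2].
have [|r [p [Dp [r0 Hp]]]] := @glue_pieces P.
  move=> x; have [Ax|nAx] := pselect (A x); last first.
    have [d d0 Hd] := closed_ball_disjoint cA nAx; exists d => // e _.
    exists (fun=> 0), (fun=> 0); split.
    - by move=> y _; exact: sd_cst.
    - by move=> y Ay /Hd.
    - by move=> y z [Ay /Hd].
    - by move=> y Ay /Hd.
  have [d1 d10 H1] := Gc x _ Ax e00; have [d2 d20 H2] := Gs x Ax _ e00.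
  exists (Num.min d1 d2); first by rewrite lt_min d10.
  move=> e ep; set rho := Num.min d1 d2.
  have rho0 : 0 < rho by rewrite lt_min d10.
  have in1 y : ball x rho y -> `|y - x| < d1.
    by rewrite in_ball lt_min => /andP[].
  have in2 y : ball x rho y -> ball x d2 y.
    by rewrite !in_ball lt_min => /andP[].
  have fG : lip (A `&` ball x rho) e0 (fun y => f y - G x y).
    move=> y z [Ay yb] [Az zb].
    have := H2 z y Az Ay (in2 _ zb) (in2 _ yb).
    by rewrite clin_sub !opprD !opprK !addrA [X in `|X| <= _ -> _](ACl (1*3*2*4)).
  have [E [EF /(_ _ _ I I) EL]] := LE _ _ _ (ltW e00) fG.
  have EL' : lip (ball x rho) (C1 * e0) E by move=> y z _ _; exact: EL.
  have [q [D [qL qD Eq]]] := LAb x rho E (C1 * e0) e rho0 (ltW C1e) ep EL'.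
  have pf y : A y -> ball x rho y -> G x y + q y - f y = q y - E y.
    by move=> Ay yb; rewrite EF // opprB addrCA addrA.
  exists (fun y => G x y + q y), (fun y => G x + D y); split.
  - by move=> y yb; apply: sdD; [exact: sd_clin|exact: qD].
  - by move=> y Ay yb; rewrite pf // distrC; exact: Eq.
  - apply: (@lip_ext _ _ (fun y => q y - E y)).
      by move=> y [Ay yb]; rewrite pf.
    move=> y z [Ay yb] [Az zb].
    rewrite (_ : _ - _ - _ = (q y - q z) - (E y - E z)); last first.
      by rewrite !opprD !opprK !addrA [LHS](ACl (1*3*2*4)).
    apply: le_trans (ler_normB _ _) _.
    have := qL _ _ yb zb; have := EL y z; have := normr_ge0 (y - z).
    rewrite -e0E => n0; have := mulr_ge0 (ltW e00) n0; lra.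
  - move=> y Ay yb.
    have Dq : `|D y| <= C2 * (C1 * e0).
      apply: (sd_norm_le (ltW C2e) (qD _ yb)).
      have := yb; rewrite in_ball => yb'.
      exists (rho - `|y - x|); first by rewrite subr_gt0.
      move=> u v; rewrite !in_ball => ub vb; apply: qL.
        by rewrite in_ball -(subrKA y); apply: le_lt_trans (ler_normD _ _) _; lra.
      by rewrite in_ball -(subrKA y); apply: le_lt_trans (ler_normD _ _) _; lra.
    rewrite [G x + _]addrC -addrA; apply: le_trans (ler_normD _ _) _.
    have := H1 _ Ay (in1 _ yb); rewrite distrC; lra.
have e20 : 0 < eta / 2 by rewrite divr_gt0.
have [|h [Dh [hD _ hL hG]]] := @smooth_gluing R X Y v0 v0n0 LA r p Dp (eta / 2) r0 e20.
  by move=> x e y ep yb; have [+ _ _ _] := Hp x e ep; apply.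
exists h, Dh; split=> //.
  rewrite [eta]splitr; apply: hL (ltW e20) _ => x e ep.
  by have [_ ? ? _] := Hp x e ep.
move=> a Aa; rewrite [eta]splitr; apply: hG (f a) _ _ (ltW e20) _ => x e ep ab.
by have [_ + _ +] := Hp x e ep => /(_ a Aa ab) ? /(_ a Aa ab).
Qed.

End Approximation.

(** * Global Lipschitz control *)

Section GlobalLipschitz.
Context {R : realType} {X Y : normedModType R}.
Implicit Types (A : set X) (f : X -> Y) (G : X -> clin X Y).

(** Take x and y in balls of radii d a / 4 and d b / 4 around a and b, with
    d b <= d a. If |x - y| < d a / 4, both points are in the ball of
    radius d a around a. Otherwise |x - a| and |y - b| are at most |x - y|,
    and going through a and b costs 2L + 3L + 2L times |x - y|. *)
Lemma lip_near_union A (d : X -> R) f L : 0 <= L -> lip A L f ->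
  (forall a, A a -> 0 < d a /\ lip (ball a (d a)) (2 * L) f) ->
  lip [set x | exists2 a, A a & ball a (d a / 4) x] (7 * L) f.
Proof.
move=> L0 fA fd.
have main x y a b : A a -> A b -> ball a (d a / 4) x -> ball b (d b / 4) y ->
    d b <= d a -> `|f x - f y| <= 7 * L * `|x - y|.
  move=> Aa Ab; rewrite !in_ball => xa yb dba.
  have [da fa] := fd a Aa; have [db fb] := fd b Ab.
  have Ln := mulr_ge0 L0 (normr_ge0 (x - y)).
  have [xy|xy] := ltP `|x - y| (d a / 4).
    apply: le_trans (fa _ _ _ _) _; rewrite ?in_ball; [lra| |lra].
    rewrite -(subrKA x); apply: le_lt_trans (ler_normD _ _) _.
    by rewrite (distrC y); lra.
  have fxa : `|f x - f a| <= 2 * L * `|x - a|.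
    by apply: fa; rewrite in_ball ?subrr ?normr0 //; lra.
  have fyb : `|f y - f b| <= 2 * L * `|y - b|.
    by apply: fb; rewrite in_ball ?subrr ?normr0 //; lra.
  have fab := fA _ _ Aa Ab.
  have ab : `|a - b| <= 3 * `|x - y|.
    rewrite -[a - b](subrKA x) -[x - b](subrKA y).
    have := ler_normD (a - x) (x - y + (y - b)).
    have := ler_normD (x - y) (y - b).
    by rewrite (distrC a x); lra.
  have H1 : L * `|a - b| <= L * (3 * `|x - y|) by rewrite ler_wpM2l.
  have H2 : L * `|x - a| <= L * `|x - y| by rewrite ler_wpM2l //; lra.
  have H3 : L * `|y - b| <= L * `|x - y| by rewrite ler_wpM2l //; lra.
  rewrite -[f x - f y](subrKA (f a)) -[f a - f y](subrKA (f b)).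
  have := ler_normD (f x - f a) (f a - f b + (f b - f y)).
  have := ler_normD (f a - f b) (f b - f y).
  rewrite (distrC (f b)); lra.
move=> x y [a Aa xa] [b Ab yb].
have [dab|/ltW dba] := leP (d b) (d a); first exact: main dab.
by rewrite distrC (distrC x); exact: main dba.
Qed.

(** Since Dh is bounded by L on A, h is 2L-Lipschitz near every point of A,
    hence Lipschitz on a neighbourhood W of A. A Lipschitz extension H of h
    from W to X equals h near A, so it is a smooth piece there; off A the
    pieces are smooth approximations of H. All the pieces are close to H, so
    the result is Lipschitz like H. *)
Lemma make_lipschitz (v0 : Y) : v0 != 0 ->
  property_LE X Y -> property_LA X Y (Some 1%N) -> exists2 K : R, 0 < K &
  forall A h (Dh : X -> clin X Y) L, closed A -> 0 < L ->
    (forall x, sd h (Dh x) x) -> lip A L h -> (forall a, A a -> `|Dh a| <= L) ->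
  exists g Dg, [/\ forall x, sd g (Dg x) x, lip setT (K * L) g,
    forall a, A a -> g a = h a &
    forall a, A a -> `|Dg a - Dh a| <= L / 8].
Proof.
move=> v0n0 /property_LE_lip[C1 C10 LE] LA; have [C2 C20 LAb] := property_LA_ball LA.
have C12 : 0 < C2 * C1 by rewrite mulr_gt0.
exists (7 * C1 + 7 * C1 + 7 * (C2 * C1) + 1); first by lra.
move=> A h Dh L cA L0 hD hA DhL.
have /choice[d Hd] a : exists d : R, 0 < d /\ (A a -> lip (ball a d) (2 * L) h).
  have [d d0 dl] := hD a L L0; exists d; split=> // Aa y z yb zb.
  rewrite -[h y - h z](subrK (Dh a (y - z))).
  apply: le_trans (ler_normD _ _) _.
  rewrite !in_ball in yb zb; have := dl _ _ zb yb; have := clin_le (Dh a) (y - z).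
  have := ler_wpM2r (normr_ge0 (y - z)) (DhL a Aa); lra.
pose W := [set x | exists2 a, A a & ball a (d a / 4) x].
have L70 : 0 <= 7 * L by lra.
have WL : lip W (7 * L) h.
  apply: lip_near_union (ltW L0) hA _ => a Aa; have [d0 ld] := Hd a.
  by split=> //; exact: ld.
have [H [HW HL]] := LE _ _ _ L70 WL.
have CL0 : 0 <= C1 * (7 * L) by rewrite mulr_ge0 // ltW.
pose P (x : X) (rho e : R) (p : X -> Y) (D : X -> clin X Y) :=
  [/\ forall y, ball x rho y -> sd p (D y) y,
      forall y, ball x rho y -> `|p y - H y| <= e,
      lip (ball x rho) (C2 * (C1 * (7 * L)) + C1 * (7 * L)) (fun y => p y - H y) &
      forall y, A y -> ball x rho y -> p y = h y /\ D y = Dh y].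
have CC0 : 0 <= C2 * (C1 * (7 * L)) by rewrite mulr_ge0 // ltW.
have [|r [p [Dp [r0 Hp]]]] := @glue_pieces R X Y P.
  move=> x; have [Ax|nAx] := pselect (A x).
    have [d0 _] := Hd x; exists (d x / 4); first by rewrite divr_gt0.
    move=> e e0; exists H, Dh; split.
    - move=> y; rewrite in_ball => yx; apply: sd_eq_near (hD y).
      exists (d x / 4 - `|y - x|); first by rewrite subr_gt0.
      move=> z zy; apply/esym/HW; exists x => //; rewrite in_ball -(subrKA y).
      by apply: le_lt_trans (ler_normD _ _) _; lra.
    - by move=> y _; rewrite subrr normr0 ltW.
    - by move=> y z _ _; rewrite !subrr normr0 mulr_ge0 // addr_ge0.
    - by move=> y Ay yb; split=> //; apply: HW; exists x.
  have [rho rho0 Hrho] := closed_ball_disjoint cA nAx; exists rho => // e e0.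
  have HL' : lip (ball x rho) (C1 * (7 * L)) H by move=> y z _ _; exact: HL.
  have [q [D [qL qD qH]]] := LAb x rho H _ e rho0 CL0 e0 HL'.
  exists q, D; split=> //.
  - by move=> y yb; rewrite distrC; exact: qH.
  - move=> y z yb zb; rewrite (_ : _ - _ - _ = (q y - q z) - (H y - H z)).
      apply: le_trans (ler_normB _ _) _; rewrite mulrDl.
      by apply: lerD; [exact: qL|exact: HL'].
    by rewrite !opprD !opprK !addrA [LHS](ACl (1*3*2*4)).
  - by move=> y Ay /Hrho.
have L80 : 0 < L / 8 by rewrite divr_gt0.
have [|g [Dg [gD gh gL gG]]] := @smooth_gluing R X Y v0 v0n0 LA r p Dp (L / 8) r0 L80.
  by move=> x e y e0 yb; have [+ _ _ _] := Hp x e e0; apply.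
exists g, Dg; split=> //.
- have HB : lip setT (C2 * (C1 * (7 * L)) + C1 * (7 * L) + L / 8) (fun y => g y - H y).
    apply: gL; first by rewrite addr_ge0.
    move=> x e e0; have [_ pH pL _] := Hp x e e0; rewrite setTI; split=> //.
    by move=> y _; exact: pH.
  have := lipD HB HL; set c := (X in lip _ X _) => cl.
  apply: (@lip_le R X Y _ c); first by rewrite /c; lra.
  by apply: lip_ext cl => y _ /=; rewrite subrK.
- move=> a Aa; apply: gh => x e e0 ab; have [_ _ _ ph] := Hp x e e0.
  by have [] := ph a Aa ab.
- move=> a Aa; rewrite -[L / 8]add0r; apply: (gG a (h a)) => // x e e0 ab.
  have [_ _ _ ph] := Hp x e e0; have [-> ->] := ph a Aa ab.
  by rewrite !subrr !normr0 ltW.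
Qed.

(** [approx_derivative] gives h, which on A is close to f in the Lipschitz
    sense and has almost the same derivative; [make_lipschitz] changes neither
    the values of h on A nor, essentially, its derivatives there. *)
Lemma halving_step (v0 : Y) : v0 != 0 ->
  property_LE X Y -> property_LA X Y (Some 1%N) -> exists2 K : R, 0 < K &
  forall A f G L, closed A -> whitney_pair A f G -> 0 < L ->
    lip A L f -> (forall a, A a -> `|G a| <= L) ->
  exists g Dg, [/\ forall x, sd g (Dg x) x, lip setT (K * L) g,
    lip A (L / 2) (fun y => f y - g y) &
    forall a, A a -> `|G a - Dg a| <= L / 2].
Proof.
move=> v0n0 LE LA; have [K K0 HK] := make_lipschitz v0n0 LE LA.
exists (2 * K); first by rewrite mulr_gt0.
move=> A f G L cA W L0 fL GL.
have L40 : 0 < L / 4 by rewrite divr_gt0.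
have [h [Dh [hD hf hG]]] := approx_derivative v0n0 LE LA cA W L40.
have L20 : 0 < 2 * L by rewrite mulr_gt0.
have hL : lip A (2 * L) h.
  apply: (@lip_le R X Y _ (L / 4 + L)); first by lra.
  by apply: lip_ext (lipD hf fL) => y _ /=; rewrite subrK.
have DhL a : A a -> `|Dh a| <= 2 * L.
  move=> Aa; rewrite -[Dh a](subrK (G a)); apply: le_trans (ler_normD _ _) _.
  by have := hG a Aa; have := GL a Aa; lra.
have [g [Dg [gD gL gh gDh]]] := HK A h Dh (2 * L) cA L20 hD hL DhL.
exists g, Dg; split=> //; first by rewrite [2 * K]mulrC -mulrA.
  move=> y z Ay Az; rewrite !gh //.
  rewrite (_ : _ - _ - _ = h z - f z - (h y - f y)); last first.
    by rewrite !opprB [RHS]addrC.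
  apply: le_trans (hf z y Az Ay) _; rewrite distrC ler_wpM2r //; lra.
move=> a Aa; rewrite -(subrKA (Dh a)); apply: le_trans (ler_normD _ _) _.
have := hG a Aa; have := gDh a Aa; rewrite distrC [`|Dh a - G a|]distrC; lra.
Qed.

End GlobalLipschitz.

(** * Extension *)

Section Extension.
Context {R : realType} {X : normedModType R} {Y : completeNormedModType R}.
Implicit Types (A : set X) (f : X -> Y) (G : X -> clin X Y).

(** The n-th partial sum S n leaves on A a remainder f - S n that is
    L 2^-n-Lipschitz and vanishes at a0; each S (n+1) - S n is
    KL 2^-n-Lipschitz. So the sums converge together with their derivatives,
    and the remainder tends to 0 on A. *)
Lemma lipschitz_extension (v0 : Y) : v0 != 0 ->
  property_LE X Y -> property_LA X Y (Some 1%N) -> exists2 K : R, 0 < K &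
  forall A f G L, closed A -> whitney_pair A f G -> 0 < L ->
    lip A L f -> (forall a, A a -> `|G a| <= L) ->
  exists g Dg, [/\ forall x, sd g (Dg x) x, forall a, A a -> g a = f a &
    lip setT (K * L) g].
Proof.
move=> v0n0 LE LA; have [K K0 HK] := halving_step v0n0 LE LA.
exists (2 * K); first by rewrite mulr_gt0.
move=> A f G L cA W L0 fL GL.
have [[a0 Aa0]|nA] := pselect (exists a, A a); last first.
  exists (fun=> 0), (fun=> 0); split.
  - by move=> x; exact: sd_cst.
  - by move=> a Aa; case: nA; exists a.
  - by move=> y z _ _; rewrite subrr normr0 !mulr_ge0 // ltW.
pose hf n : R := 2^-1 ^+ n.
have hf0 n : 0 < hf n by rewrite exprn_gt0 // invr_gt0.
have hfS n : hf n = 2 * hf n.+1 by rewrite /hf exprS; lra.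
have hf_anti m n : (m <= n)%N -> hf n <= hf m.
  by move=> mn; apply: ler_wiXn2l => //; lra.
pose state := ((X -> Y) * (X -> clin X Y))%type.
pose Inv n (s : state) := [/\ forall x, sd s.1 (s.2 x) x,
  lip A (L * hf n) (fun y => f y - s.1 y),
  forall a, A a -> `|G a - s.2 a| <= L * hf n & s.1 a0 = f a0].
have /choice[next nextP] (ns : nat * state) : exists s' : state,
    Inv ns.1 ns.2 -> Inv ns.1.+1 s' /\
      lip setT (K * L * hf ns.1) (fun y => s'.1 y - ns.2.1 y).
  case: ns => n s /=; have [|nI] := pselect (Inv n s); last by exists s.
  move=> [sD sL sG s0].
  have [k [Dk [kD kL kf kG]]] := HK A _ _ (L * hf n) cA (whitney_pairB W sD)
    (mulr_gt0 L0 (hf0 n)) sL sG.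
  (* Subtracting k a0 keeps the value at a0, where all the partial sums
     agree with f; this anchors the pointwise convergence. *)
  exists (fun y => s.1 y + (k y - k a0), fun y => s.2 y + Dk y) => _; split; last first.
    move=> y z _ _ /=; have := kL y z I I; rewrite mulrA => H.
    rewrite (_ : _ - _ - _ = k y - k z) //.
    by rewrite ![s.1 _ + _]addrC !addrK opprB addrA subrK.
  split=> /=.
  - move=> x; have := sdD (sD x) (sdB (kD x) (sd_cst (k a0) x)).
    by rewrite subr0.
  - move=> y z Ay Az; have := kf y z Ay Az.
    rewrite (_ : L * hf n / 2 = L * hf n.+1); last by rewrite hfS; lra.
    have E (a b c d a' b' c' : Y) :
        a - (b + (c - d)) - (a' - (b' + (c' - d))) = a - b - c - (a' - b' - c').
      rewrite !opprD !opprK !addrA [LHS](ACl (1*2*3*5*6*7*(4*8))) /=.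
      by rewrite subrr addr0.
    by rewrite E.
  - move=> a Aa; have := kG a Aa; rewrite opprD addrA.
    by rewrite (_ : L * hf n / 2 = L * hf n.+1) //; rewrite hfS; lra.
  - by rewrite subrr addr0.
pose S := fix S n := if n is n'.+1 then next (n', S n') else (fun=> f a0, fun=> 0) : state.
have SI n : Inv n (S n).
  elim: n => [|n IH] /=; last by have [] := nextP (n, S n) IH.
  split=> //= [x|y z Ay Az|a Aa]; first exact: sd_cst.
    rewrite opprB addrA subrK /hf expr0 mulr1; exact: fL.
  by rewrite subr0 /hf expr0 mulr1; exact: GL.
have KL0 : 0 < K * L by rewrite mulr_gt0.
have Sstep n : lip setT (K * L * hf n) (fun y => (S n.+1).1 y - (S n).1 y).
  by have [_] := nextP (n, S n) (SI n).
have Sdiff n m : (n <= m)%N ->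
    lip setT (2 * (K * L) * (hf n - hf m)) (fun y => (S m).1 y - (S n).1 y).
  move=> nm; rewrite -(subnK nm); elim: (m - n)%N => [|i IH].
    by rewrite add0n => y z _ _; rewrite !subrr normr0 mulr0 mul0r.
  have := lipD (Sstep (i + n)%N) IH; rewrite addSn; set c := (X in lip _ X _) => cl.
  apply: (@lip_le R X Y _ c); first by rewrite /c (hfS (i + n)%N); lra.
  by apply: lip_ext cl => y _ /=; rewrite subrKA.
have Slip n m : (n <= m)%N ->
    lip setT (2 * (K * L) * hf n) (fun y => (S m).1 y - (S n).1 y).
  move=> /Sdiff; apply: lip_le.
  by rewrite ler_wpM2l ?mulr_ge0 // ?ltW //; have := hf0 m; lra.
have /choice[g gP] y : exists l, forall n,
    `|l - (S n).1 y| <= (2 * (K * L) * `|y - a0|) * 2^-1 ^+ n.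
  apply: geo_cauchy_lim => n m nm; have := Slip n m nm y a0 I I.
  have [_ _ _ ->] := SI m; have [_ _ _ ->] := SI n.
  by rewrite subrr subr0 mulrAC.
have gS n : lip setT (2 * (K * L) * 2^-1 ^+ n) (fun y => g y - (S n).1 y).
  move=> y z _ _; rewrite -subr_le0.
  apply: (@le0_geo _ (2 * (K * L) * `|y - a0| + 2 * (K * L) * `|z - a0|)) => i.
  have [im nm] := (leq_maxl i n, leq_maxr i n); set m := maxn i n in im nm.
  have := Slip n m nm y z I I; have := gP y m; have := gP z m.
  have -> : g y - (S n).1 y - (g z - (S n).1 z) =
    ((S m).1 y - (S n).1 y - ((S m).1 z - (S n).1 z))
    + (g y - (S m).1 y) - (g z - (S m).1 z).
    have E (a b a' b' c c' : Y) :
        a - b - (a' - b') = c - b - (c' - b') + (a - c) - (a' - c').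
      rewrite !opprD !opprK !addrA [RHS](ACl (5*2*7*4*(1*6)*(3*8))) /=.
      by rewrite subrr addNr !addr0.
    exact: E.
  set u := _ - _ - (_ - _); set v := g y - _; set w := g z - _ => H1 H2 H3.
  have H4 := ler_normB (u + v) w; have H5 := ler_normD u v.
  have : (2 * (K * L) * `|y - a0| + 2 * (K * L) * `|z - a0|) * hf m <=
     (2 * (K * L) * `|y - a0| + 2 * (K * L) * `|z - a0|) * hf i.
    rewrite ler_wpM2l //; last exact: hf_anti.
    by rewrite addr_ge0 // !mulr_ge0 // ltW.
  rewrite /hf in H3 *; lra.
have KL20 : 0 <= 2 * (K * L) by rewrite mulr_ge0 // ltW.
have /choice[Dg DgP] x : exists T, sd g T x.
  apply: (@sd_limit R X Y (fun n => (S n).1) (fun n => (S n).2 x) g (2 * (K * L))) => // n.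
  by have [] := SI n.
exists g, Dg; split=> // [a Aa|y z _ _].
  apply/eqP; rewrite -subr_eq0 -normr_le0.
  apply: (@le0_geo _ (2 * (K * L) * `|a - a0| + L * `|a - a0|)) => n.
  rewrite -(subrKA ((S n).1 a)); apply: le_trans (ler_normD _ _) _.
  rewrite mulrDl; apply: lerD; first exact: gP.
  have [_ + _ S0] := SI n => /(_ a a0 Aa Aa0).
  by rewrite S0 subrr subr0 distrC mulrAC.
have := gS 0%N y z I I; rewrite expr0 mulr1 /=.
by rewrite opprB addrA subrK mulrA.
Qed.

(** The pieces agree with f on A, and gluing preserves exact common values. *)
Lemma smooth_extension (v0 : Y) A f G : v0 != 0 ->
  property_LE X Y -> property_LA X Y (Some 1%N) -> closed A -> whitney_pair A f G ->
  exists g Dg, (forall x, sd g (Dg x) x) /\ forall a, A a -> g a = f a.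
Proof.
move=> v0n0 LE LA cA W; have [K K0 HK] := lipschitz_extension v0n0 LE LA.
pose P (x : X) (rho e : R) (p : X -> Y) (D : X -> clin X Y) :=
  (forall y, ball x rho y -> sd p (D y) y) /\
  (forall y, A y -> ball x rho y -> p y = f y).
have [|r [p [Dp [r0 Hp]]]] := @glue_pieces R X Y P.
  move=> x; have [Ax|nAx] := pselect (A x); last first.
    have [d d0 Hd] := closed_ball_disjoint cA nAx; exists d => // e _.
    exists (fun=> 0), (fun=> 0); split=> y; first by move=> _; exact: sd_cst.
    by move=> Ay /Hd.
  have [Gc Gs] := W.
  have [d1 d10 H1] := Gc x 1 Ax ltr01; have [d2 d20 H2] := Gs x Ax 1 ltr01.
  pose rho := Num.min d1 d2 / 2.
  have m0 : 0 < Num.min d1 d2 by rewrite lt_min d10.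
  have rho0 : 0 < rho by rewrite divr_gt0.
  exists rho => // e _.
  pose B := A `&` closed_ball x rho.
  have cB : closed B by apply: closedI => //; exact: closed_ball_closed.
  have inB y : closed_ball x rho y -> `|y - x| < d1 /\ ball x d2 y.
    rewrite closed_ballE // /closed_ball_ /= in_ball distrC => yx.
    by have : `|y - x| < Num.min d1 d2; [rewrite /rho in yx; lra|rewrite lt_min => /andP].
  have BA : B `<=` A by move=> y [].
  have L0 : 0 < `|G x| + 1 by rewrite ltr_wpDl.
  have [|a [Aa /inB[ad _]]|g [Dg [gD gf _]]] := HK B f G (`|G x| + 1) cB (whitney_pair_subset BA W) L0.
  - move=> y z [Ay /inB[_ yb]] [Az /inB[_ zb]].
    rewrite -[f y - f z](subrK (G x (y - z))) mulrDl addrC.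
    apply: le_trans (ler_normD _ _) _; apply: lerD; first exact: clin_le.
    exact: H2 Az Ay zb yb.
  - rewrite -[G a](subrK (G x)) addrC; apply: le_trans (ler_normD _ _) _.
    by rewrite lerD2l; exact: H1.
  exists g, Dg; split=> // y Ay yb; apply: gf; split=> //.
  exact: subset_closed_ball yb.
have [|g [Dg [gD gh _ _]]] := @smooth_gluing R X Y v0 v0n0 LA r p Dp 1 r0 ltr01.
  by move=> x e y e0 yb; have [+ _] := Hp x e e0; apply.
exists g, Dg; split=> // a Aa; apply: gh => x e e0 ab.
by have [_] := Hp x e e0; apply.
Qed.

End Extension.

Theorem theorem1 (R : realType) (X Y : completeNormedModType R) :
  property_LE X Y -> property_LA X Y (Some 1%N) ->
  exists2 K : R, 0 < K &
    forall (A : set X) (f : X -> Y) (G : X -> clin X Y),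
      closed A -> condition_W A f G ->
      (exists g : X -> Y,
         Ck (Some 1%N) setT g /\ (forall x, A x -> g x = f x)) /\
      (forall L : R, 0 <= L -> L.-lipschitz_A f ->
         (forall x, A x -> `|G x| <= L) ->
         exists g : X -> Y,
           [/\ Ck (Some 1%N) setT g, (forall x, A x -> g x = f x) &
               (K * L).-lipschitz g]).
Proof.
move=> LE LA.
(* Cutoffs require a nonzero vector in Y, and the halving step requires L > 0;
   in the remaining cases a constant map is an extension. *)
have const_ext (c : Y) : Ck (Some 1%N) setT (fun _ : X => c).
  by apply: (@sd_Cn1 R X Y _ (fun=> 0)) => x; exact: sd_cst.
have [[v0 v0n0]|Y0] := pselect (exists v0 : Y, v0 != 0); last first.
  have all0 (y : Y) : y = 0.
    by apply/eqP; apply: contraT => y0; case: Y0; exists y.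
  exists 1 => // A f G _ _; split=> [|L L0 _ _]; exists (fun=> 0).
    by split=> [|x _]; [exact: const_ext|exact/esym/all0].
  split=> [|x _|]; [exact: const_ext|exact/esym/all0|].
  by apply/lipP => y z _ _; rewrite subrr normr0 !mulr_ge0.
have [K K0 HK] := lipschitz_extension v0n0 LE LA.
exists K => // A f G cA /condition_W_pair W; split.
  have [g [Dg [gD gf]]] := smooth_extension v0n0 LE LA cA W.
  by exists g; split=> //; exact: sd_Cn1 gD.
move=> L L0 /lipP fL GL; have [L1|L1] := ltP 0 L.
  have [g [Dg [gD gf gL]]] := HK A f G L cA W L1 fL GL.
  by exists g; split=> //; [exact: sd_Cn1 gD|apply/lipP].
have {L1} LE0 : L = 0 by apply/eqP; rewrite eq_le L1.
have lipc (c : Y) : (K * L).-lipschitz (fun _ : X => c).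
  by apply/lipP => y z _ _; rewrite subrr normr0 LE0 mulr0 mul0r.
have [[a Aa]|nA] := pselect (exists a, A a); last first.
  by exists (fun=> 0); split=> // x Ax; case: nA; exists x.
exists (fun=> f a); split=> // x Ax; apply/eqP; rewrite -subr_eq0 -normr_le0.
by apply: le_trans (fL _ _ Aa Ax) _; rewrite LE0 mul0r.
Qed.
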